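(* Let $k\in\mathbb N$, $0<\alpha\le1$ and $f\in\mathcal C^{k,\alpha}(\mathbb S^2)$. Then $\sum_{n\in\mathbb Z^2}|c_n(\tilde f)|<\infty$, the Fourier series of $\tilde f$ converges to $\tilde f$ uniformly on $\mathbb T^2$ (along any expanding sequence of bounded sets exhausting $\mathbb Z^2$), and for every finite $\Omega\subset\mathbb Z^2$, $$\|\tilde f-F_\Omega\tilde f\|_{\mathcal C(\mathbb T^2)}\le\sum_{n\in\mathbb Z^2\setminus\Omega}|c_n(\tilde f)|.$$ Further, the DFS Fourier series of $f$ converges to $f$ uniformly on $\mathbb S^2$ (along any expanding sequence of bounded sets exhausting $\mathbb Z\times\mathbb N_0$), and for every finite $\Omega\subset\mathbb Z\times\mathbb N_0$, $$\|f-S_\Omega f\|_{\mathcal C(\mathbb S^2)}\le\sum_{n\in\mathbb Z^2\setminus\tilde\Omega}|c_n(\tilde f)|,\qquad \tilde\Omega:=\Omega\cup M(\Omega).$$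
   Context: Notation: $\|\cdot\|$ Euclidean norm; $B^d_k:=\{\beta\in\mathbb N_0^d: |\beta|=\sum_i\beta_i\le k\}$. For open $U\subset\mathbb R^d$: $\mathcal C^k(U)$ the bounded uniformly continuous complex functions whose classical derivatives $D^\beta f$, $\beta\in B^d_k$, are bounded and uniformly continuous; for $0<\alpha<1$, $\mathcal C^{k,\alpha}(U)$ those $f\in\mathcal C^k(U)$ with $\sup\{|D^\beta f(x)-D^\beta f(y)|/\|x-y\|^\alpha: x\ne y,|\beta|=k\}<\infty$. Sphere: for $0\le\alpha<1$, $f\colon\mathbb S^2\to\mathbb C$ is in $\mathcal C^{k,\alpha}(\mathbb S^2)$ iff the infimum, over all $f^*\in\mathcal C^{k,\alpha}(U)$ with $U\supset\mathbb S^2$ open and $f^*|_{\mathbb S^2}=f$ ($\mathcal C^{k,0}=\mathcal C^k$), of $\sum_{\beta\in B^3_k}\sup_{\mathbb S^2}|D^\beta f^*|$ plus (if $\alpha>0$) $\sup\{|D^\beta f^*(\xi)-D^\beta f^*(\eta)|/\|\xi-\eta\|^\alpha:\xi\ne\eta\in\mathbb S^2,|\beta|=k\}$ is finite. Convention: $\mathcal C^{k,1}(\mathbb S^2):=\mathcal C^{k+1}(\mathbb S^2)$. $\mathbb T^2=\mathbb R^2/(2\pi\mathbb Z^2)$; $\|g\|_{\mathcal C(X)}=\sup_X|g|$. $\phi(\lambda,\theta)=(\cos\lambda\sin\theta,\sin\lambda\sin\theta,\cos\theta)$, DFS function $\tilde f=f\circ\phi$; $\phi^{-1}$ is the inverse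 of the restriction of $\phi$ to $[-\pi,\pi)\times(0,\pi)\cup\{(0,0),(0,\pi)\}$. $c_n(g)=(2\pi)^{-2}\int_{\mathbb T^2}g(x)e^{-i\langle n,x\rangle}dx$, $F_\Omega g(x)=\sum_{n\in\Omega}c_n(g)e^{i\langle n,x\rangle}$. $M(n_1,n_2)=(n_1,-n_2)$; $e_n(x)=e^{i\langle n,x\rangle}+(-1)^{n_1}e^{i\langle M(n),x\rangle}$ if $n_2\ne0$, $e_n(x)=e^{i\langle n,x\rangle}$ if $n_2=0$; $b_n=e_n\circ\phi^{-1}$ for $n\in\mathbb Z\times\mathbb N_0$; $S_\Omega f(\xi)=\sum_{n\in\Omega}c_n(\tilde f)b_n(\xi)$, and the DFS Fourier series is $\lim_h S_{\Omega_h}f$ for expanding bounded $\Omega_h$ exhausting $\mathbb Z\times\mathbb N_0$. *)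

(* Defs.v *)
From Stdlib Require Import Reals Lra ZArith List ClassicalEpsilon.
From Coquelicot Require Import Coquelicot.
Open Scope R_scope.

Definition R3 : Type := (R * R * R)%type.
Definition p1 (p : R3) : R := fst (fst p).
Definition p2 (p : R3) : R := snd (fst p).
Definition p3 (p : R3) : R := snd p.

Definition dist3 (x y : R3) : R :=
  sqrt ((p1 x - p1 y) ^ 2 + (p2 x - p2 y) ^ 2 + (p3 x - p3 y) ^ 2).

Definition on_sphere (p : R3) : Prop := p1 p ^ 2 + p2 p ^ 2 + p3 p ^ 2 = 1.

Definition open3 (U : R3 -> Prop) : Prop :=
  forall x, U x -> exists r, 0 < r /\ forall y, dist3 x y < r -> U y.

Definition shift (x : R3) (i : nat) (t : R) : R3 :=
  match i with
  | 0%nat => (p1 x + t, p2 x, p3 x)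
  | 1%nat => (p1 x, p2 x + t, p3 x)
  | _ => (p1 x, p2 x, p3 x + t)
  end.

Definition has_part (i : nat) (g : R3 -> C) (x : R3) : Prop :=
  ex_derive (fun t => fst (g (shift x i t))) 0 /\
  ex_derive (fun t => snd (g (shift x i t))) 0.

Definition dpart (i : nat) (g : R3 -> C) : R3 -> C :=
  fun x => (Derive (fun t => fst (g (shift x i t))) 0,
            Derive (fun t => snd (g (shift x i t))) 0).

Definition Dbeta (b1 b2 b3 : nat) (g : R3 -> C) : R3 -> C :=
  Nat.iter b1 (dpart 0) (Nat.iter b2 (dpart 1) (Nat.iter b3 (dpart 2) g)).

(* All classical derivatives D^beta g, |beta| <= k, exist on U:
   each step of the iterated differentiation exists at every point of U. *)
Definition derivs_exist (k : nat) (U : R3 -> Prop) (g : R3 -> C) : Prop :=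
  forall b1 b2 b3 : nat, (b1 + b2 + b3 < k)%nat -> forall x, U x ->
    has_part 0 (Dbeta b1 b2 b3 g) x /\
    (b1 = 0%nat -> has_part 1 (Dbeta 0 b2 b3 g) x) /\
    (b1 = 0%nat -> b2 = 0%nat -> has_part 2 (Dbeta 0 0 b3 g) x).

Definition bounded_on (U : R3 -> Prop) (h : R3 -> C) : Prop :=
  exists M, forall x, U x -> Cmod (h x) <= M.

Definition unif_cont_on (U : R3 -> Prop) (h : R3 -> C) : Prop :=
  forall eps, 0 < eps -> exists delta, 0 < delta /\
    forall x y, U x -> U y -> dist3 x y < delta -> Cmod (Cminus (h x) (h y)) < eps.

Definition Ck (k : nat) (U : R3 -> Prop) (g : R3 -> C) : Prop :=
  derivs_exist k U g /\
  forall b1 b2 b3 : nat, (b1 + b2 + b3 <= k)%nat ->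
    bounded_on U (Dbeta b1 b2 b3 g) /\ unif_cont_on U (Dbeta b1 b2 b3 g).

Definition Ckalpha (k : nat) (alpha : R) (U : R3 -> Prop) (g : R3 -> C) : Prop :=
  Ck k U g /\
  forall b1 b2 b3 : nat, (b1 + b2 + b3 = k)%nat ->
    exists M, forall x y, U x -> U y -> x <> y ->
      Cmod (Cminus (Dbeta b1 b2 b3 g x) (Dbeta b1 b2 b3 g y))
        <= M * Rpower (dist3 x y) alpha.

(* C^{k,alpha}(S^2) for 0 < alpha < 1, and C^{k,1}(S^2) := C^{k+1}(S^2):
   f has an extension f* in C^{k,alpha}(U) (resp. C^{k+1}(U)) to an open U
   containing S^2.  (The infimum in the definition is finite iff such an
   extension exists, since the norm of any such extension is finite.) *)
Definition Ckalpha_S2 (k : nat) (alpha : R) (f : R3 -> C) : Prop :=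
  exists (U : R3 -> Prop) (fs : R3 -> C),
    open3 U /\ (forall x, on_sphere x -> U x) /\
    (forall x, on_sphere x -> fs x = f x) /\
    (if Rlt_dec alpha 1 then Ckalpha k alpha U fs else Ck (S k) U fs).

Definition phi (p : R * R) : R3 :=
  (cos (fst p) * sin (snd p), sin (fst p) * sin (snd p), cos (snd p)).

Definition dfs (f : R3 -> C) : R * R -> C := fun x => f (phi x).

Definition phi_dom (p : R * R) : Prop :=
  (- PI <= fst p < PI /\ 0 < snd p < PI) \/ p = (0, 0) \/ p = (0, PI).

(* inverse of the (bijective) restriction phi : phi_dom -> S^2 *)
Definition phi_inv (xi : R3) : R * R :=
  epsilon (inhabits (0, 0)) (fun p => phi_dom p /\ phi p = xi).

Definition cis (t : R) : C := (cos t, sin t).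

Definition ip (n : Z * Z) (x : R * R) : R :=
  IZR (fst n) * fst x + IZR (snd n) * snd x.

Definition int_T2 (h : R * R -> R) : R :=
  RInt (fun x1 => RInt (fun x2 => h (x1, x2)) (- PI) PI) (- PI) PI.

Definition fcoef (g : R * R -> C) (n : Z * Z) : C :=
  (/ (2 * PI) ^ 2 * int_T2 (fun x => fst (Cmult (g x) (cis (- ip n x)))),
   / (2 * PI) ^ 2 * int_T2 (fun x => snd (Cmult (g x) (cis (- ip n x))))).

Fixpoint csum {A : Type} (l : list A) (F : A -> C) : C :=
  match l with
  | nil => RtoC 0
  | a :: l' => Cplus (F a) (csum l' F)
  end.

(* F_Omega g (Omega given as a duplicate-free list) *)
Definition FOmega (Om : list (Z * Z)) (g : R * R -> C) (x : R * R) : C :=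
  csum Om (fun n => Cmult (fcoef g n) (cis (ip n x))).

(* sum over { n | P n } of a nonnegative family: supremum of finite partial sums *)
Definition nnsum (a : Z * Z -> R) (P : Z * Z -> Prop) : Rbar :=
  Lub_Rbar (fun s => exists l : list (Z * Z),
    NoDup l /\ List.Forall P l /\ s = fold_right (fun n acc => a n + acc) 0 l).

Definition Mref (n : Z * Z) : Z * Z := (fst n, (- snd n)%Z).

Definition sgn1 (m : Z) : R := if Z.even m then 1 else -1.

Definition en (n : Z * Z) (x : R * R) : C :=
  if Z.eq_dec (snd n) 0 then cis (ip n x)
  else Cplus (cis (ip n x)) (Cmult (RtoC (sgn1 (fst n))) (cis (ip (Mref n) x))).

Definition bn (n : Z * Z) (xi : R3) : C := en n (phi_inv xi).

Definition SOmega (Om : list (Z * Z)) (f : R3 -> C) (xi : R3) : C :=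
  csum Om (fun n => Cmult (fcoef (dfs f) n) (bn n xi)).

(* Main.v *)
Require Import Defs.
From Stdlib Require Import Reals Lra Lia ZArith List Permutation.
From Stdlib Require Import Classical ClassicalEpsilon FunctionalExtensionality.
From Coquelicot Require Import Coquelicot.
Open Scope R_scope.

(** Write g = dfs f.  Near the sphere the extension of f has a first-order Taylor
    expansion with an error O(r^(1+a)), and the second differences of phi are O(t^2),
    so the second differences of g with step t along each axis are O(t^(1+a)).  Their
    Fourier coefficients are (2 cos(n.s) - 2) c_n(g); Bessel's inequality with
    t = pi / 2^(j+1) bounds the l^2 norm of (c_n(g)) on the dyadic shell
    2^j <= |n| < 2^(j+1) by O(2^(-j(1+a))), and Cauchy-Schwarz on its O(4^j) points
    gives O(2^(-ja)) for the l^1 norm, which is summable in j.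

    The error bound on the torus comes from the Fejer means of g: they converge to g by
    Korovkin's argument, and their weights lie in [0,1] and tend to 1, so in the limit
    |g - F_Om g| is at most the sum of |c_n(g)| over n outside Om.  On the sphere,
    g(x1, -x2) = g(x1 + pi, x2) yields c_(M n)(g) = (-1)^(n1) c_n(g), so that S_Om f is
    F_(Om u M(Om)) g composed with the inverse of phi. *)

(** * The normalised integral over the torus *)

(** Second differences are forced: a first difference of a $C^1$ function is only $O(t)$, which
    makes the $\ell^2$ norm on a shell $O(2^{-j})$ and, after Cauchy-Schwarz, the $\ell^1$ norm
    $O(1)$, not summable in $j$. The extra $t^a$ appears because the linear Taylor terms of the two
    neighbours almost cancel. Here $a=\alpha$ if $k=1$ and $\alpha<1$; in every other case the
    extension is $C^2$ and $a=1$.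

    The expansion is made in $\mathbb R^3$ for the extension, so that no derivative of the composite
    with [phi] is ever formed; [phi] enters only through trigonometric identities.

    Summability alone does not say that the series sums to $g$. The Fejer comparison settles this
    and gives the error bound at the same time. It rests on the single estimate [korovkin], whose
    right-hand side is made of terms $1-\cos$: their means against the kernel are explicit, and the
    same estimate also yields continuity of $g$.

    Functions on the torus are functions on $\mathbb R^2$, with periodicity as a separate
    predicate. *)

Definition cont (h : R * R -> R) : Prop := forall x, continuous h x.

Lemma cont_const (c : R) : cont (fun _ => c).
Proof. intros x; apply continuous_const. Qed.

Lemma cont_plus (h1 h2 : R * R -> R) :
  cont h1 -> cont h2 -> cont (fun x => h1 x + h2 x).
Proof. intros H1 H2 x; exact (continuous_plus h1 h2 x (H1 x) (H2 x)). Qed.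

Lemma cont_minus (h1 h2 : R * R -> R) :
  cont h1 -> cont h2 -> cont (fun x => h1 x - h2 x).
Proof. intros H1 H2 x; exact (continuous_minus h1 h2 x (H1 x) (H2 x)). Qed.

Lemma cont_mult (h1 h2 : R * R -> R) :
  cont h1 -> cont h2 -> cont (fun x => h1 x * h2 x).
Proof. intros H1 H2 x; exact (continuous_mult h1 h2 x (H1 x) (H2 x)). Qed.

Lemma cont_comp (p : R -> R) (h : R * R -> R) :
  (forall t, continuous p t) -> cont h -> cont (fun x => p (h x)).
Proof. intros Hp Hh x; apply continuous_comp; auto. Qed.

Lemma cont_fst : cont fst.
Proof. intros [a b]; apply continuous_fst. Qed.

Lemma cont_snd : cont snd.
Proof. intros [a b]; apply continuous_snd. Qed.

Lemma cont_comp_pair (h p q : R * R -> R) :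
  cont h -> cont p -> cont q -> cont (fun x => h (p x, q x)).
Proof.
  intros Hh Hp Hq x.
  apply (continuous_comp_2 p q (fun a b => h (a, b)) x); auto.
  eapply continuous_ext; [ | exact (Hh (p x, q x))].
  now intros [a b].
Qed.

Lemma cont_ext (h1 h2 : R * R -> R) :
  (forall x, h1 x = h2 x) -> cont h1 -> cont h2.
Proof. intros E H x; eapply continuous_ext; [exact E | apply H]. Qed.

Lemma cont_cos (h : R * R -> R) : cont h -> cont (fun x => cos (h x)).
Proof. apply cont_comp, continuous_cos. Qed.

Lemma cont_sin (h : R * R -> R) : cont h -> cont (fun x => sin (h x)).
Proof. apply cont_comp, continuous_sin. Qed.

Create HintDb cont.
#[local] Hint Resolve cont_const cont_plus cont_minus cont_mult cont_fst cont_snd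
  cont_cos cont_sin : cont.

Lemma cont_section (h : R * R -> R) (a t : R) :
  cont h -> continuous (fun b => h (a, b)) t.
Proof.
  intros H.
  apply (continuous_comp_2 (fun _ => a) (fun b : R => b) (fun a b => h (a, b)) t).
  - apply continuous_const.
  - apply continuous_id.
  - eapply continuous_ext; [ | exact (H (a, t))]. now intros [u v].
Qed.

Lemma cont_2d (h : R * R -> R) (a b : R) :
  cont h -> continuity_2d_pt (fun u v => h (u, v)) a b.
Proof.
  intros H; apply continuity_2d_pt_filterlim; simpl.
  eapply filterlim_ext; [ | exact (H (a, b))].
  now intros [u v].
Qed.

Lemma ex_RInt_cont (p : R -> R) (a b : R) :
  (forall t, continuous p t) -> ex_RInt p a b.
Proof. intros H; apply (ex_RInt_continuous p); auto. Qed.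

Lemma ex_RInt_section (h : R * R -> R) (x a b : R) :
  cont h -> ex_RInt (fun t => h (x, t)) a b.
Proof. intros H; apply ex_RInt_cont; intros t; now apply cont_section. Qed.

(** Compactness of $[a,b]$ gives one [d] that serves for all [y]. This continuity is what makes the
    outer integral in [int_T2] exist. *)
Lemma continuous_RInt_section (h : R * R -> R) (a b t : R) :
  a <= b -> cont h -> continuous (fun x => RInt (fun y => h (x, y)) a b) t.
Proof.
  intros Hab H.
  apply continuity_pt_filterlim.
  intros eps Heps.
  (* The [+ 1] covers [a = b]; the factor 2 turns the non-strict integral bound into a strict
     one. *)
  assert (He : 0 < eps / (2 * (b - a + 1))).
  { apply Rdiv_lt_0_compat; lra. }
  destruct (uniform_continuity_2d_1d' (fun u v => h (u, v)) a b t
              (fun x _ => cont_2d h t x H) (mkposreal _ He)) as [d Hd].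
  simpl in Hd.
  exists d; split; [apply cond_pos | ].
  intros x [_ Hx]; simpl in *; unfold R_dist in *.
  replace (RInt (fun y => h (x, y)) a b - RInt (fun y => h (t, y)) a b)
    with (RInt (fun y => h (x, y) - h (t, y)) a b).
  2:{ apply (RInt_minus (fun y => h (x, y)) (fun y => h (t, y)));
      now apply ex_RInt_section. }
  apply Rle_lt_trans with ((b - a) * (eps / (2 * (b - a + 1)))).
  - apply abs_RInt_le_const; auto.
    + apply (ex_RInt_minus (fun y => h (x, y)) (fun y => h (t, y)));
      now apply ex_RInt_section.
    + intros y Hy. left.
      apply Rabs_def2 in Hx. pose proof (cond_pos d).
      apply Hd; try lra.
      replace (y - y) with 0 by ring. rewrite Rabs_R0; lra.
  - apply (Rmult_lt_reg_r (2 * (b - a + 1))); [lra | ].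
    field_simplify; [nra | lra].
Qed.

Lemma PI_le : - PI <= PI.
Proof. pose proof PI_RGT_0; lra. Qed.

(** The normalisation is that of [fcoef], so [fcoef_cmean] holds by computation. *)
Definition mean (h : R * R -> R) : R := / (2 * PI) ^ 2 * int_T2 h.

Lemma ex_RInt_outer (h : R * R -> R) :
  cont h -> ex_RInt (fun x => RInt (fun y => h (x, y)) (- PI) PI) (- PI) PI.
Proof.
  intros H; apply ex_RInt_cont; intros t.
  apply continuous_RInt_section; auto using PI_le.
Qed.

Lemma mean_ext (h1 h2 : R * R -> R) : (forall x, h1 x = h2 x) -> mean h1 = mean h2.
Proof.
  intros E; unfold mean, int_T2; f_equal.
  apply RInt_ext; intros x _; apply RInt_ext; intros y _; apply E.
Qed.

Lemma mean_plus (h1 h2 : R * R -> R) :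
  cont h1 -> cont h2 -> mean (fun x => h1 x + h2 x) = mean h1 + mean h2.
Proof.
  intros H1 H2; unfold mean, int_T2.
  rewrite <- Rmult_plus_distr_l; f_equal.
  rewrite <- (RInt_plus (fun x => RInt (fun y => h1 (x, y)) (- PI) PI)
    (fun x => RInt (fun y => h2 (x, y)) (- PI) PI)) by now apply ex_RInt_outer.
  apply RInt_ext; intros x _.
  apply (RInt_plus (fun y => h1 (x, y)) (fun y => h2 (x, y)));
    now apply ex_RInt_section.
Qed.

Lemma mean_scal (c : R) (h : R * R -> R) :
  cont h -> mean (fun x => c * h x) = c * mean h.
Proof.
  intros H; unfold mean, int_T2.
  transitivity (/ (2 * PI) ^ 2 * (c * RInt (fun x => RInt (fun y => h (x, y)) (- PI) PI) (- PI) PI)); [ | ring].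
  f_equal.
  rewrite <- (RInt_scal (fun x => RInt (fun y => h (x, y)) (- PI) PI)) by now apply ex_RInt_outer.
  apply RInt_ext; intros x _.
  apply (RInt_scal (fun y => h (x, y))); now apply ex_RInt_section.
Qed.

Lemma mean_minus (h1 h2 : R * R -> R) :
  cont h1 -> cont h2 -> mean (fun x => h1 x - h2 x) = mean h1 - mean h2.
Proof.
  intros H1 H2.
  rewrite (mean_ext _ (fun x => h1 x + (-1) * h2 x)) by (intros; ring).
  rewrite mean_plus, mean_scal; auto with cont. ring.
Qed.

Lemma RInt_const_R (c a b : R) : RInt (fun _ => c) a b = (b - a) * c.
Proof. exact (RInt_const a b c). Qed.

Lemma mean_const (c : R) : mean (fun _ => c) = c.
Proof.
  unfold mean, int_T2. rewrite !RInt_const_R. field. apply PI_neq0.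
Qed.

Lemma mean_le (h1 h2 : R * R -> R) :
  cont h1 -> cont h2 -> (forall x, h1 x <= h2 x) -> mean h1 <= mean h2.
Proof.
  intros H1 H2 L; unfold mean, int_T2.
  apply Rmult_le_compat_l.
  { left; apply Rinv_0_lt_compat, pow_lt; pose proof PI_RGT_0; lra. }
  apply RInt_le; auto using PI_le, ex_RInt_outer.
  intros x _; apply RInt_le; auto using PI_le, ex_RInt_section.
Qed.

Lemma RInt_shift (p : R -> R) (s a b : R) :
  (forall t, continuous p t) ->
  RInt (fun t => p (t + s)) a b = RInt p (a + s) (b + s).
Proof.
  intros H.
  rewrite <- (Rmult_1_l a) at 2. rewrite <- (Rmult_1_l b) at 2.
  rewrite <- (RInt_comp_lin p 1 s a b) by now apply ex_RInt_cont.
  apply RInt_ext; intros t _.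
  change (p (t + s) = 1 * p (1 * t + s)). now rewrite !Rmult_1_l.
Qed.

(** The integral from $-\pi$ to $\pi+s$ is split in two ways; the pieces of length $s$ at the two
    ends agree by periodicity. *)
Lemma RInt_shift_periodic (p : R -> R) (s : R) :
  (forall t, continuous p t) -> (forall t, p (t + 2 * PI) = p t) ->
  RInt (fun t => p (t + s)) (- PI) PI = RInt p (- PI) PI.
Proof.
  intros H P.
  rewrite RInt_shift by assumption.
  assert (E : RInt p PI (PI + s) = RInt p (- PI) (- PI + s)).
  { replace PI with (- PI + 2 * PI) at 1 by ring.
    replace (PI + s) with (- PI + s + 2 * PI) by ring.
    rewrite <- RInt_shift by assumption.
    apply RInt_ext; auto. }
  assert (I : forall a b, ex_RInt p a b) by (intros; now apply ex_RInt_cont).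
  pose proof (RInt_Chasles p (- PI) (- PI + s) (PI + s) (I _ _) (I _ _)) as C1.
  pose proof (RInt_Chasles p (- PI) PI (PI + s) (I _ _) (I _ _)) as C2.
  unfold plus in C1, C2; simpl in C1, C2. lra.
Qed.

Definition periodic (h : R * R -> R) : Prop :=
  forall x y, h (x + 2 * PI, y) = h (x, y) /\ h (x, y + 2 * PI) = h (x, y).

Lemma mean_shift (h : R * R -> R) (s : R * R) :
  cont h -> periodic h ->
  mean (fun x => h (fst x + fst s, snd x + snd s)) = mean h.
Proof.
  intros H P; unfold mean, int_T2; f_equal; simpl.
  transitivity (RInt (fun x => RInt (fun y => h (x + fst s, y)) (- PI) PI) (- PI) PI).
  - apply RInt_ext; intros x _.
    apply (RInt_shift_periodic (fun y => h (x + fst s, y))).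
    + intros t; now apply cont_section.
    + intros t; apply P.
  - apply (RInt_shift_periodic (fun x => RInt (fun y => h (x, y)) (- PI) PI)).
    + intros t; apply continuous_RInt_section; auto using PI_le.
    + intros t; apply RInt_ext; intros y _; apply P.
Qed.

Lemma mean_reflect (h : R * R -> R) :
  cont h -> mean (fun x => h (fst x, - snd x)) = mean h.
Proof.
  intros H; unfold mean, int_T2; f_equal; simpl.
  apply RInt_ext; intros x _.
  pose proof (RInt_comp_lin (fun y => h (x, y)) (-1) 0 (- PI) PI) as E.
  replace (-1 * - PI + 0) with PI in E by ring.
  replace (-1 * PI + 0) with (- PI) in E by ring.
  specialize (E (ex_RInt_section _ _ _ _ H)).
  rewrite <- (opp_RInt_swap (fun y => h (x, y))) in E by now apply ex_RInt_section.
  rewrite (RInt_ext _ (fun y => scal (-1) (h (x, - y)))) in E.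
  2:{ intros y _; do 3 f_equal; ring. }
  rewrite (RInt_scal (fun y => h (x, - y))) in E.
  2:{ apply ex_RInt_cont; intros t.
      apply (continuous_comp (fun y => - y) (fun y => h (x, y))).
      - apply (continuous_opp (fun y : R => y)), continuous_id.
      - now apply cont_section. }
  unfold scal, opp in E; simpl in E; unfold mult in E; simpl in E. lra.
Qed.
(** * Fourier coefficients *)

Definition ccont (h : R * R -> C) : Prop :=
  cont (fun x => fst (h x)) /\ cont (fun x => snd (h x)).

Definition cmean (h : R * R -> C) : C :=
  (mean (fun x => fst (h x)), mean (fun x => snd (h x))).

(** The squared modulus as a polynomial in the components, so that continuity and [ring] apply
    without a square root. *)
Definition csq (z : C) : R := fst z ^ 2 + snd z ^ 2.

(** Convertible with the partial sums inside [nnsum]. *)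
Definition rsum {A : Type} (l : list A) (F : A -> R) : R :=
  fold_right (fun n acc => F n + acc) 0 l.

Lemma csq_Cmod (z : C) : csq z = Cmod z ^ 2.
Proof.
  unfold csq, Cmod. rewrite pow2_sqrt; auto.
  pose proof (pow2_ge_0 (fst z)); pose proof (pow2_ge_0 (snd z)); lra.
Qed.

Lemma csq_ge_0 (z : C) : 0 <= csq z.
Proof. rewrite csq_Cmod; apply pow2_ge_0. Qed.

Lemma cis_plus (a b : R) : cis (a + b) = Cmult (cis a) (cis b).
Proof. unfold cis, Cmult; simpl; rewrite cos_plus, sin_plus; f_equal; ring. Qed.

Lemma cis_0 : cis 0 = RtoC 1.
Proof. unfold cis; now rewrite cos_0, sin_0. Qed.

Lemma csq_cis (a : R) : csq (cis a) = 1.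
Proof. unfold csq, cis; simpl. pose proof (sin2_cos2 a). unfold Rsqr in *. lra. Qed.

Lemma Cmod_cis (a : R) : Cmod (cis a) = 1.
Proof.
  pose proof (csq_cis a) as E. rewrite csq_Cmod in E.
  pose proof (Cmod_ge_0 (cis a)). nra.
Qed.

Lemma ccont_const (c : C) : ccont (fun _ => c).
Proof. split; apply cont_const. Qed.

Lemma ccont_plus (h1 h2 : R * R -> C) :
  ccont h1 -> ccont h2 -> ccont (fun x => Cplus (h1 x) (h2 x)).
Proof. intros [A B] [A' B']; split; simpl; auto with cont. Qed.

Lemma ccont_minus (h1 h2 : R * R -> C) :
  ccont h1 -> ccont h2 -> ccont (fun x => Cminus (h1 x) (h2 x)).
Proof. intros [A B] [A' B']; split; simpl.
  - exact (cont_minus _ _ A A').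
  - exact (cont_minus _ _ B B').
Qed.

Lemma ccont_mult (h1 h2 : R * R -> C) :
  ccont h1 -> ccont h2 -> ccont (fun x => Cmult (h1 x) (h2 x)).
Proof. intros [A B] [A' B']; split; simpl; auto with cont. Qed.

Lemma ccont_cis (h : R * R -> R) : cont h -> ccont (fun x => cis (h x)).
Proof. intros H; split; simpl; auto with cont. Qed.

Lemma cont_ip (n : Z * Z) : cont (ip n).
Proof. unfold ip; auto with cont. Qed.

Lemma cont_ip_opp (n : Z * Z) : cont (fun x => - ip n x).
Proof.
  apply (cont_ext (fun x => 0 - ip n x)); [intros; ring | ].
  apply cont_minus; [apply cont_const | apply cont_ip].
Qed.

Lemma ccont_csum {A : Type} (l : list A) (F : A -> R * R -> C) :
  (forall n, ccont (F n)) -> ccont (fun x => csum l (fun n => F n x)).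
Proof.
  intros H; induction l as [ | n l IH]; simpl.
  - apply ccont_const.
  - now apply ccont_plus.
Qed.

Lemma cont_csq (h : R * R -> C) : ccont h -> cont (fun x => csq (h x)).
Proof.
  intros [A B]; unfold csq; simpl.
  auto using cont_plus, cont_mult, cont_const.
Qed.

#[local] Hint Resolve ccont_const ccont_plus ccont_minus ccont_mult ccont_cis cont_ip
  cont_ip_opp cont_csq : cont.

Lemma cmean_ext (h1 h2 : R * R -> C) : (forall x, h1 x = h2 x) -> cmean h1 = cmean h2.
Proof. intros E; unfold cmean; f_equal; apply mean_ext; intros; now rewrite E. Qed.

Lemma cmean_plus (h1 h2 : R * R -> C) : ccont h1 -> ccont h2 ->
  cmean (fun x => Cplus (h1 x) (h2 x)) = Cplus (cmean h1) (cmean h2).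
Proof.
  intros [A B] [A' B']; unfold cmean, Cplus; simpl; f_equal; now apply mean_plus.
Qed.

Lemma cmean_scal (c : C) (h : R * R -> C) : ccont h ->
  cmean (fun x => Cmult c (h x)) = Cmult c (cmean h).
Proof.
  intros [A B]; unfold cmean, Cmult; simpl; f_equal.
  - rewrite mean_minus, !mean_scal; auto with cont.
  - rewrite mean_plus, !mean_scal; auto with cont.
Qed.

Lemma cmean_minus (h1 h2 : R * R -> C) : ccont h1 -> ccont h2 ->
  cmean (fun x => Cminus (h1 x) (h2 x)) = Cminus (cmean h1) (cmean h2).
Proof.
  intros H1 H2.
  rewrite (cmean_ext _ (fun x => Cplus (h1 x) (Cmult (Copp (RtoC 1)) (h2 x)))).
  - rewrite cmean_plus, cmean_scal; auto with cont. ring.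
  - intros x; ring.
Qed.

Lemma cmean_csum {A : Type} (l : list A) (F : A -> R * R -> C) :
  (forall n, ccont (F n)) ->
  cmean (fun x => csum l (fun n => F n x)) = csum l (fun n => cmean (F n)).
Proof.
  intros H; induction l as [ | n l IH]; simpl.
  - unfold cmean; simpl. now rewrite mean_const.
  - rewrite cmean_plus, IH; auto using ccont_csum.
Qed.

Lemma cmean_const (c : C) : cmean (fun _ => c) = c.
Proof. unfold cmean; rewrite !mean_const; now destruct c. Qed.

(** Rotation trick: with $z$ the mean of $h$, $|z|^2$ is the mean of $\mathrm{Re}(\bar z h)\le|z|q$;
    then $|z|$ is cancelled. *)
Lemma Cmod_cmean_le (h : R * R -> C) (q : R * R -> R) :
  ccont h -> cont q -> (forall x, Cmod (h x) <= q x) -> Cmod (cmean h) <= mean q.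
Proof.
  intros H Hq L.
  set (z := cmean h).
  assert (E : Cmod z * Cmod z <= Cmod z * mean q).
  { rewrite <- mean_scal by assumption.
    replace (Cmod z * Cmod z) with (fst (cmean (fun x => Cmult (Cconj z) (h x)))).
    2:{ rewrite cmean_scal by assumption. fold z.
        transitivity (csq z); [unfold csq; simpl; ring | rewrite csq_Cmod; ring]. }
    unfold cmean at 1; cbv [fst].
    apply mean_le; auto with cont.
    { apply (ccont_mult (fun _ => Cconj z) h); auto with cont. }
    intros x.
    eapply Rle_trans; [apply Rle_abs | ].
    eapply Rle_trans; [apply (Rmax_l _ (Rabs (snd (Cmult (Cconj z) (h x))))) | ].
    eapply Rle_trans; [apply Rmax_Cmod | ].
    rewrite Cmod_mult, Cmod_conj.
    apply Rmult_le_compat_l; [apply Cmod_ge_0 | apply L]. }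
  destruct (Req_dec (Cmod z) 0) as [Z | Z].
  - rewrite Z. apply Rle_trans with (mean (fun _ => 0)); [rewrite mean_const; lra | ].
    apply mean_le; auto with cont. intros x; eapply Rle_trans; [apply Cmod_ge_0 | apply L].
  - pose proof (Cmod_ge_0 z). apply Rmult_le_reg_l in E; lra.
Qed.

Lemma sin_IZR_PI (n : Z) : sin (IZR n * PI) = 0.
Proof. apply sin_eq_0_1; now exists n. Qed.

(** The phase [a] carries the term $n_1x_1$ while the integration runs over $x_2$ only. *)
Lemma RInt_cos_lin (a : R) (n : Z) : n <> 0%Z ->
  RInt (fun t => cos (a + IZR n * t)) (- PI) PI = 0.
Proof.
  intros Hn. apply not_0_IZR in Hn.
  apply is_RInt_unique.
  replace 0 with (minus (sin (a + IZR n * PI) / IZR n) (sin (a + IZR n * - PI) / IZR n)).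
  - apply (is_RInt_derive (fun t => sin (a + IZR n * t) / IZR n)).
    + intros t _; auto_derive; auto; field; auto.
    + intros t _. apply (continuous_comp (fun t => a + IZR n * t) cos).
      * apply (ex_derive_continuous (fun t => a + IZR n * t)); auto_derive; auto.
      * apply continuous_cos.
  - unfold minus, plus, opp; simpl.
    replace (IZR n * - PI) with (- (IZR n * PI)) by ring.
    rewrite !sin_plus, cos_neg, sin_neg, sin_IZR_PI. field; auto.
Qed.

Lemma RInt_sin_lin (a : R) (n : Z) : n <> 0%Z ->
  RInt (fun t => sin (a + IZR n * t)) (- PI) PI = 0.
Proof.
  intros Hn. rewrite <- (RInt_cos_lin (a - PI / 2) n Hn).
  apply RInt_ext; intros t _.
  rewrite <- (cos_shift (a + IZR n * t)), <- cos_neg. f_equal; ring.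
Qed.

Definition Zp_dec (n m : Z * Z) : {n = m} + {n <> m}.
Proof. repeat decide equality. Qed.

(** The Coquelicot rewrites leave equations typed in a structure carrier that is only convertible to
    [R]; the [change] exposes [R] to [ring]. *)
Ltac Rring := match goal with |- @eq _ ?a ?b => change (@eq R a b) end; ring.

Lemma cmean_cis (n : Z * Z) :
  cmean (fun x => cis (ip n x)) = if Zp_dec n (0, 0)%Z then RtoC 1 else RtoC 0.
Proof.
  destruct n as [n1 n2].
  destruct (Zp_dec (n1, n2) (0, 0)%Z) as [E | E].
  - injection E as -> ->.
    rewrite <- (cmean_const (RtoC 1)) at 1. apply cmean_ext; intros x.
    unfold ip; simpl. rewrite <- cis_0; f_equal; ring.
  - unfold cmean, mean, int_T2, ip; simpl.
    (* If $n_2\ne0$ the inner integral already vanishes; otherwise $n_1\ne0$ and the outer one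
       does. *)
    destruct (Z.eq_dec n2 0) as [-> | N2].
    + assert (N1 : n1 <> 0%Z) by congruence.
      unfold RtoC; f_equal.
      * rewrite (RInt_ext _ (fun x => 2 * PI * cos (0 + IZR n1 * x))).
        2:{ intros x _. rewrite (RInt_ext _ (fun _ => cos (0 + IZR n1 * x))).
            - rewrite RInt_const_R; Rring.
            - intros y _; apply (f_equal cos); simpl; ring. }
        rewrite (RInt_scal (fun x => cos (0 + IZR n1 * x))), RInt_cos_lin; auto.
        { unfold scal; simpl; unfold mult; simpl; ring. }
        apply ex_RInt_cont; intros t.
        apply (ex_derive_continuous (fun x => cos (0 + IZR n1 * x))); auto_derive; auto.
      * rewrite (RInt_ext _ (fun x => 2 * PI * sin (0 + IZR n1 * x))).
        2:{ intros x _. rewrite (RInt_ext _ (fun _ => sin (0 + IZR n1 * x))).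
            - rewrite RInt_const_R; Rring.
            - intros y _; apply (f_equal sin); simpl; ring. }
        rewrite (RInt_scal (fun x => sin (0 + IZR n1 * x))), RInt_sin_lin; auto.
        { unfold scal; simpl; unfold mult; simpl; ring. }
        apply ex_RInt_cont; intros t.
        apply (ex_derive_continuous (fun x => sin (0 + IZR n1 * x))); auto_derive; auto.
    + unfold RtoC; f_equal.
      * rewrite (RInt_ext _ (fun _ => 0)) by (intros; now apply RInt_cos_lin).
        rewrite RInt_const_R; ring.
      * rewrite (RInt_ext _ (fun _ => 0)) by (intros; now apply RInt_sin_lin).
        rewrite RInt_const_R; ring.
Qed.

Lemma fcoef_cmean (g : R * R -> C) (n : Z * Z) :
  fcoef g n = cmean (fun x => Cmult (g x) (cis (- ip n x))).
Proof. reflexivity. Qed.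

Lemma fcoef_ext (g1 g2 : R * R -> C) (n : Z * Z) :
  (forall x, g1 x = g2 x) -> fcoef g1 n = fcoef g2 n.
Proof. intros E; rewrite !fcoef_cmean; apply cmean_ext; intros; now rewrite E. Qed.

Lemma ccont_fcoef (g : R * R -> C) (n : Z * Z) :
  ccont g -> ccont (fun x => Cmult (g x) (cis (- ip n x))).
Proof. intros; auto with cont. Qed.

#[local] Hint Resolve ccont_fcoef : cont.

Lemma fcoef_plus (g1 g2 : R * R -> C) (n : Z * Z) : ccont g1 -> ccont g2 ->
  fcoef (fun x => Cplus (g1 x) (g2 x)) n = Cplus (fcoef g1 n) (fcoef g2 n).
Proof.
  intros; rewrite !fcoef_cmean, <- cmean_plus; auto with cont.
  apply cmean_ext; intros; ring.
Qed.

Lemma fcoef_minus (g1 g2 : R * R -> C) (n : Z * Z) : ccont g1 -> ccont g2 ->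
  fcoef (fun x => Cminus (g1 x) (g2 x)) n = Cminus (fcoef g1 n) (fcoef g2 n).
Proof.
  intros; rewrite !fcoef_cmean, <- cmean_minus; auto with cont.
  apply cmean_ext; intros; ring.
Qed.

Lemma fcoef_scal (c : C) (g : R * R -> C) (n : Z * Z) : ccont g ->
  fcoef (fun x => Cmult c (g x)) n = Cmult c (fcoef g n).
Proof.
  intros; rewrite !fcoef_cmean, <- cmean_scal; auto with cont.
  apply cmean_ext; intros; ring.
Qed.

Lemma fcoef_cis (m n : Z * Z) :
  fcoef (fun x => cis (ip m x)) n = if Zp_dec m n then RtoC 1 else RtoC 0.
Proof.
  rewrite fcoef_cmean.
  rewrite (cmean_ext _ (fun x => cis (ip (fst m - fst n, snd m - snd n)%Z x))).
  - rewrite cmean_cis. destruct m as [m1 m2], n as [n1 n2]; simpl.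
    destruct (Zp_dec (m1 - n1, m2 - n2)%Z (0, 0)%Z) as [E | E], (Zp_dec (m1, m2) (n1, n2)) as [E' | E']; auto.
    + injection E as E1 E2. elim E'; f_equal; lia.
    + injection E' as -> ->. elim E; f_equal; lia.
  - intros x; rewrite <- cis_plus; f_equal; unfold ip; simpl; rewrite !minus_IZR; ring.
Qed.

Definition cperiodic (g : R * R -> C) : Prop :=
  periodic (fun x => fst (g x)) /\ periodic (fun x => snd (g x)).

Lemma cis_period (a : R) (n : Z) : cis (a + IZR n * (2 * PI)) = cis a.
Proof.
  rewrite cis_plus. replace (cis (IZR n * (2 * PI))) with (RtoC 1); [ring | ].
  unfold cis, RtoC.
  replace (IZR n * (2 * PI)) with (2 * (IZR n * PI)) by ring.
  now rewrite cos_2a_sin, sin_2a, !sin_IZR_PI, !Rmult_0_r, Rmult_0_l, Rminus_0_r.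
Qed.

Lemma fcoef_shift (g : R * R -> C) (s : R * R) (n : Z * Z) :
  ccont g -> cperiodic g ->
  fcoef (fun x => g (fst x + fst s, snd x + snd s)) n
  = Cmult (cis (ip n s)) (fcoef g n).
Proof.
  intros Hg [P1 P2].
  rewrite !fcoef_cmean.
  set (k := fun x => Cmult (g x) (cis (- ip n x))).
  assert (Hk : ccont k) by (unfold k; auto with cont).
  assert (Pk : cperiodic k).
  { assert (A : forall x y, k (x + 2 * PI, y) = k (x, y) /\ k (x, y + 2 * PI) = k (x, y)).
    { intros x y; unfold k; split; f_equal.
      - apply injective_projections; apply (P1 x y) || apply (P2 x y).
      - rewrite <- (cis_period (- ip n (x, y)) (- fst n)).
        f_equal; unfold ip; simpl; rewrite opp_IZR; ring.
      - apply injective_projections; apply (P1 x y) || apply (P2 x y).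
      - rewrite <- (cis_period (- ip n (x, y)) (- snd n)).
        f_equal; unfold ip; simpl; rewrite opp_IZR; ring. }
    split; intros x y; destruct (A x y) as [A1 A2]; now rewrite A1, A2. }
  transitivity (Cmult (cis (ip n s)) (cmean (fun x => k (fst x + fst s, snd x + snd s)))).
  - assert (Hks : ccont (fun x => k (fst x + fst s, snd x + snd s))).
    { split.
      - apply (cont_comp_pair (fun x => fst (k x))); auto with cont; apply Hk.
      - apply (cont_comp_pair (fun x => snd (k x))); auto with cont; apply Hk. }
    rewrite <- cmean_scal by assumption.
    apply cmean_ext; intros x. unfold k.
    replace (cis (- ip n x)) with
      (Cmult (cis (ip n s)) (cis (- ip n (fst x + fst s, snd x + snd s)))); [ring | ].
    rewrite <- cis_plus; f_equal; unfold ip; simpl; ring.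
  - f_equal. unfold cmean; f_equal.
    + apply (mean_shift (fun x => fst (k x))); [apply Hk | apply Pk].
    + apply (mean_shift (fun x => snd (k x))); [apply Hk | apply Pk].
Qed.

Lemma fcoef_reflect (g : R * R -> C) (n : Z * Z) :
  ccont g -> fcoef (fun x => g (fst x, - snd x)) n = fcoef g (Mref n).
Proof.
  intros Hg. rewrite !fcoef_cmean.
  set (k := fun x => Cmult (g x) (cis (- ip (Mref n) x))).
  assert (Hk : ccont k) by (unfold k; auto with cont).
  transitivity (cmean (fun x => k (fst x, - snd x))).
  - apply cmean_ext; intros x; unfold k; do 2 f_equal.
    unfold ip, Mref; simpl; rewrite opp_IZR; ring.
  - unfold cmean; f_equal.
    + apply (mean_reflect (fun x => fst (k x))), Hk.
    + apply (mean_reflect (fun x => snd (k x))), Hk.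
Qed.

Lemma csum_ext_in {A : Type} (l : list A) (F G : A -> C) :
  (forall n, In n l -> F n = G n) -> csum l F = csum l G.
Proof.
  induction l as [ | n l IH]; simpl; intros H; auto.
  rewrite (H n), IH; auto.
Qed.

Lemma csum_0 {A : Type} (l : list A) : csum l (fun _ => RtoC 0) = RtoC 0.
Proof. induction l as [ | n l IH]; simpl; auto. rewrite IH; ring. Qed.

Lemma ccont_FOmega (Om : list (Z * Z)) (g : R * R -> C) : ccont (FOmega Om g).
Proof. unfold FOmega; apply ccont_csum; auto with cont. Qed.

(** Orthogonality of characters. It shows in [bessel_eq] that subtracting the partial sum over [l]
    leaves the coefficient at a new frequency unchanged. *)
Lemma fcoef_FOmega (Om : list (Z * Z)) (g : R * R -> C) (n : Z * Z) :
  ~ In n Om -> fcoef (FOmega Om g) n = RtoC 0.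
Proof.
  intros H. rewrite fcoef_cmean.
  rewrite (cmean_ext _ (fun x => csum Om (fun m => Cmult (fcoef g m)
             (Cmult (cis (ip m x)) (cis (- ip n x)))))).
  - rewrite cmean_csum by auto with cont.
    rewrite <- (csum_0 Om). apply csum_ext_in; intros m Hm.
    rewrite cmean_scal by auto with cont.
    rewrite <- (fcoef_cmean (fun x => cis (ip m x))), fcoef_cis.
    destruct (Zp_dec m n) as [-> | _]; [contradiction | ring].
  - intros x; unfold FOmega. induction Om as [ | m Om IH]; simpl; [ring | ].
    rewrite <- IH; [ring | ]. intros K; apply H; now right.
Qed.

Lemma csq_minus_cis (z c : C) (t : R) :
  csq (Cminus z (Cmult c (cis t)))
  = csq z + csq c - 2 * fst (Cmult (Cconj c) (Cmult z (cis (- t)))).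
Proof.
  destruct z as [z1 z2], c as [c1 c2].
  unfold csq, cis; simpl; rewrite cos_neg, sin_neg.
  pose proof (sin2_cos2 t) as S; unfold Rsqr in S.
  apply Rminus_diag_uniq.
  (* The two sides differ by a multiple of $\sin^2+\cos^2-1$. *)
  match goal with |- ?e = 0 => replace e with
    ((c1 ^ 2 + c2 ^ 2) * (sin t * sin t + cos t * cos t - 1)) by ring end.
  rewrite S; ring.
Qed.

(** One frequency is removed at a time: the residual [r] still has coefficient [c] at [n], so the
    cross term of [csq_minus_cis] has mean $2|c|^2$ and subtracting $c\,e^{i\langle n,x\rangle}$
    lowers the mean square by $|c|^2$. *)
Lemma bessel_eq (g : R * R -> C) (l : list (Z * Z)) :
  ccont g -> NoDup l ->
  mean (fun x => csq (Cminus (g x) (FOmega l g x)))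
  = mean (fun x => csq (g x)) - rsum l (fun n => csq (fcoef g n)).
Proof.
  intros Hg; induction 1 as [ | n l Hn Hl IH].
  - simpl. rewrite Rminus_0_r. apply mean_ext; intros x; f_equal.
    unfold FOmega; simpl; ring.
  - set (r := fun x => Cminus (g x) (FOmega l g x)) in *.
    set (c := fcoef g n).
    assert (Hr : ccont r) by (unfold r; auto using ccont_FOmega with cont).
    assert (Ec : fcoef r n = c).
    { unfold r; rewrite fcoef_minus, fcoef_FOmega; auto using ccont_FOmega.
      fold c; ring. }
    rewrite (mean_ext _ (fun x => csq (r x) + csq c -
       2 * fst (Cmult (Cconj c) (Cmult (r x) (cis (- ip n x)))))).
    + rewrite mean_minus, mean_plus, mean_const, mean_scal; auto with cont.
      * change (mean (fun x => fst (Cmult (Cconj c) (Cmult (r x) (cis (- ip n x))))))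
          with (fst (cmean (fun x => Cmult (Cconj c) (Cmult (r x) (cis (- ip n x)))))).
        rewrite cmean_scal by auto with cont.
        rewrite <- fcoef_cmean, Ec. unfold r; rewrite IH.
        simpl; fold c; unfold csq; simpl; ring.
      * apply (ccont_mult (fun _ => Cconj c)); auto with cont.
      * apply cont_mult; [apply cont_const | ].
        apply (ccont_mult (fun _ => Cconj c)); auto with cont.
    + intros x.
      replace (Cminus (g x) (FOmega (n :: l) g x))
        with (Cminus (r x) (Cmult c (cis (ip n x)))).
      * apply csq_minus_cis.
      * unfold r, FOmega; simpl; fold c; ring.
Qed.

Lemma bessel (g : R * R -> C) (l : list (Z * Z)) (B : R) :
  ccont g -> NoDup l -> (forall x, Cmod (g x) <= B) ->
  rsum l (fun n => csq (fcoef g n)) <= B ^ 2.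
Proof.
  intros Hg Hl HB.
  assert (0 <= mean (fun x => csq (Cminus (g x) (FOmega l g x)))).
  { rewrite <- (mean_const 0). apply mean_le; auto using ccont_FOmega with cont.
    intros; apply csq_ge_0. }
  rewrite bessel_eq in H by assumption.
  assert (mean (fun x => csq (g x)) <= B ^ 2); [ | lra].
  rewrite <- (mean_const (B ^ 2)). apply mean_le; auto with cont.
  intros x; rewrite csq_Cmod. apply pow_incr; split; [apply Cmod_ge_0 | apply HB].
Qed.

(** * Summable families on the integer lattice *)

Section RSum.
Context {A : Type}.
Implicit Types (l : list A) (F G : A -> R).

Lemma rsum_ext_in l F G : (forall n, In n l -> F n = G n) -> rsum l F = rsum l G.
Proof.
  induction l as [ | n l IH]; simpl; intros H; auto.
  rewrite (H n), IH; auto.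
Qed.

Lemma rsum_le l F G : (forall n, In n l -> F n <= G n) -> rsum l F <= rsum l G.
Proof.
  induction l as [ | n l IH]; simpl; intros H; [lra | ].
  apply Rplus_le_compat; auto.
Qed.

Lemma rsum_plus l F G : rsum l (fun n => F n + G n) = rsum l F + rsum l G.
Proof. induction l as [ | n l IH]; simpl; [ring | rewrite IH; ring]. Qed.

Lemma rsum_scal l (c : R) F : rsum l (fun n => c * F n) = c * rsum l F.
Proof. induction l as [ | n l IH]; simpl; [ring | rewrite IH; ring]. Qed.

Lemma rsum_const l (c : R) : rsum l (fun _ => c) = INR (length l) * c.
Proof.
  induction l as [ | n l IH]; [simpl; ring | ].
  change (length (n :: l)) with (S (length l)). rewrite S_INR. simpl; rewrite IH; ring.
Qed.

Lemma rsum_app l1 l2 F : rsum (l1 ++ l2) F = rsum l1 F + rsum l2 F.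
Proof. induction l1 as [ | n l IH]; simpl; [ring | rewrite IH; ring]. Qed.

Lemma rsum_filter l (p : A -> bool) F :
  rsum (filter p l) F = rsum l (fun n => if p n then F n else 0).
Proof.
  induction l as [ | n l IH]; simpl; auto.
  destruct (p n); simpl; rewrite IH; ring.
Qed.

Lemma rsum_filter_split l (p : A -> bool) F :
  rsum l F = rsum (filter p l) F + rsum (filter (fun n => negb (p n)) l) F.
Proof.
  rewrite !rsum_filter, <- rsum_plus. apply rsum_ext_in; intros n _.
  destruct (p n); simpl; ring.
Qed.

Lemma rsum_permutation l1 l2 F : Permutation l1 l2 -> rsum l1 F = rsum l2 F.
Proof. induction 1; simpl; lra. Qed.

Lemma Cmod_csum_le l (F : A -> C) : Cmod (csum l F) <= rsum l (fun n => Cmod (F n)).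
Proof.
  induction l as [ | n l IH]; simpl; [rewrite Cmod_0; lra | ].
  eapply Rle_trans; [apply Cmod_triangle | lra].
Qed.

Lemma csum_permutation l1 l2 (F : A -> C) : Permutation l1 l2 -> csum l1 F = csum l2 F.
Proof. induction 1; simpl; [auto | congruence | ring | congruence]. Qed.

Lemma csum_app l1 l2 (F : A -> C) : csum (l1 ++ l2) F = Cplus (csum l1 F) (csum l2 F).
Proof. induction l1 as [ | n l IH]; simpl; [ring | rewrite IH; ring]. Qed.

Lemma csum_plus l (F G : A -> C) :
  csum l (fun n => Cplus (F n) (G n)) = Cplus (csum l F) (csum l G).
Proof. induction l as [ | n l IH]; simpl; [ring | rewrite IH; ring]. Qed.

Lemma csum_scal l (c : C) (F : A -> C) :
  csum l (fun n => Cmult c (F n)) = Cmult c (csum l F).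
Proof. induction l as [ | n l IH]; simpl; [ring | rewrite IH; ring]. Qed.

Lemma csum_filter l (p : A -> bool) (F : A -> C) :
  csum (filter p l) F = csum l (fun n => if p n then F n else RtoC 0).
Proof.
  induction l as [ | n l IH]; simpl; auto.
  destruct (p n); simpl; rewrite IH; ring.
Qed.

End RSum.

(** Each step adds the pair $\pm N$ at the head, which matches the recursion of [dirichlet]. *)
Fixpoint zrange (N : nat) : list Z :=
  match N with
  | O => 0%Z :: nil
  | S N' => Z.of_nat N :: (- Z.of_nat N)%Z :: zrange N'
  end.

Definition zbox (N : nat) : list (Z * Z) := list_prod (zrange N) (zrange N).

Lemma zrange_In (N : nat) (k : Z) : In k (zrange N) <-> (Z.abs k <= Z.of_nat N)%Z.
Proof.
  induction N as [ | N IH]; simpl zrange.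
  - simpl; lia.
  - simpl In. rewrite IH. lia.
Qed.

Lemma zrange_NoDup (N : nat) : NoDup (zrange N).
Proof.
  induction N as [ | N IH].
  - repeat constructor; simpl; tauto.
  - simpl zrange. constructor; [ | constructor; auto].
    + simpl In. rewrite zrange_In. lia.
    + rewrite zrange_In. lia.
Qed.

Lemma zrange_length (N : nat) : length (zrange N) = (2 * N + 1)%nat.
Proof. induction N as [ | N IH]; simpl in *; lia. Qed.

Definition znorm (n : Z * Z) : Z := Z.max (Z.abs (fst n)) (Z.abs (snd n)).

Lemma zbox_In (N : nat) (n : Z * Z) : In n (zbox N) <-> (znorm n <= Z.of_nat N)%Z.
Proof.
  destruct n as [a b]; unfold zbox, znorm; rewrite in_prod_iff, !zrange_In; simpl; lia.
Qed.

Lemma NoDup_list_prod {A B : Type} (l : list A) (l' : list B) :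
  NoDup l -> NoDup l' -> NoDup (list_prod l l').
Proof.
  intros Hl Hl'; induction Hl as [ | a l Ha Hl IH]; simpl; [constructor | ].
  apply NoDup_app; auto.
  - apply FinFun.Injective_map_NoDup; auto. intros x y E; congruence.
  - intros [x y] H1 H2. apply in_map_iff in H1; destruct H1 as [z [E _]].
    apply in_prod_iff in H2. injection E as -> _. tauto.
Qed.

Lemma zbox_NoDup (N : nat) : NoDup (zbox N).
Proof. apply NoDup_list_prod; apply zrange_NoDup. Qed.

Lemma zbox_length (N : nat) : length (zbox N) = ((2 * N + 1) * (2 * N + 1))%nat.
Proof. unfold zbox. now rewrite length_prod, zrange_length. Qed.

Lemma znorm_list_bound (l : list (Z * Z)) :
  exists N : nat, forall n, In n l -> (znorm n <= Z.of_nat N)%Z.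
Proof.
  induction l as [ | n l [N IH]].
  - exists 0%nat; intros n [].
  - exists (N + Z.to_nat (znorm n))%nat. intros m [-> | Hm].
    + assert (0 <= znorm m)%Z by (unfold znorm; lia). lia.
    + specialize (IH m Hm). lia.
Qed.

(** * Summation over dyadic shells *)

Section Dyadic.
Variables (c : Z * Z -> R) (K r : R).
Hypothesis c_ge_0 : forall n, 0 <= c n.
Hypothesis K_ge_0 : 0 <= K.
Hypothesis r_bounds : 0 < r < 1.
Hypothesis shell : forall (j : nat) (l : list (Z * Z)), NoDup l ->
  (forall n, In n l -> (2 ^ Z.of_nat j <= znorm n < 2 ^ Z.of_nat (S j))%Z) ->
  rsum l (fun n => c n ^ 2) <= K * ((1 / 4) ^ j * (r ^ j * r ^ j)).

(** 25 bounds the number of points of a shell divided by $4^j$, [K] is the $\ell^2$ constant, and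
    the 2 comes from the AM-GM inequality. *)
Let D : R := (25 + K) / 2.

(* Cauchy-Schwarz on the shell, as the pointwise AM-GM bound c <= (s + c^2/s)/2. *)
Lemma dyadic_shell (j : nat) (l : list (Z * Z)) : NoDup l ->
  (forall n, In n l -> (2 ^ Z.of_nat j <= znorm n < 2 ^ Z.of_nat (S j))%Z) ->
  rsum l c <= D * r ^ j.
Proof.
  intros Hl Hn.
  pose proof (shell j l Hl Hn) as S1.
  assert (Hq : 0 < (1 / 4) ^ j) by (apply pow_lt; lra).
  assert (Hr : 0 < r ^ j) by (apply pow_lt; lra).
  set (q := (1 / 4) ^ j) in *. set (p := r ^ j) in *.
  assert (Hs : 0 < q * p) by now apply Rmult_lt_0_compat.
  (* The shell lies in the box of radius $2\cdot2^j$, which has $(4\cdot2^j+1)^2\le(5\cdot2^j)^2$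
     points. *)
  assert (L : INR (length l) * q <= 25).
  { assert (L1 : (length l <= (5 * 2 ^ j) * (5 * 2 ^ j))%nat).
    { apply Nat.le_trans with (length (zbox (2 * 2 ^ j))).
      - apply NoDup_incl_length; auto. intros n Hin. apply zbox_In.
        destruct (Hn n Hin) as [_ H].
        rewrite Nat2Z.inj_succ, Z.pow_succ_r in H by lia.
        rewrite Nat2Z.inj_mul, Nat2Z.inj_pow. lia.
      - rewrite zbox_length. pose proof (Nat.pow_nonzero 2 j).
        apply Nat.mul_le_mono; lia. }
    apply le_INR in L1. rewrite !mult_INR, pow_INR in L1.
    replace (INR 5) with 5 in L1 by (simpl; ring).
    replace (INR 2) with 2 in L1 by (simpl; ring).
    assert (E : 2 ^ j * 2 ^ j * q = 1).
    { unfold q. rewrite <- !Rpow_mult_distr.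
      replace (2 * 2 * (1 / 4)) with 1 by field. apply pow1. }
    apply Rle_trans with (5 * 2 ^ j * (5 * 2 ^ j) * q).
    - apply Rmult_le_compat_r; lra.
    - replace (5 * 2 ^ j * (5 * 2 ^ j) * q) with (25 * (2 ^ j * 2 ^ j * q)) by ring.
      rewrite E; lra. }
  (* The choice $s=4^{-j}r^j$ balances the two halves: the constant terms add up to at most
     $\frac{25}2r^j$, the squares to at most $\frac K2r^j$. *)
  apply Rle_trans with (rsum l (fun n => q * p / 2 + / (2 * (q * p)) * c n ^ 2)).
  - apply rsum_le; intros n _.
    apply (Rmult_le_reg_l (2 * (q * p))); [lra | ].
    replace (2 * (q * p) * (q * p / 2 + / (2 * (q * p)) * c n ^ 2))
      with ((q * p) ^ 2 + c n ^ 2) by (field; lra).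
    pose proof (pow2_ge_0 (q * p - c n)). lra.
  - rewrite rsum_plus, rsum_const, rsum_scal. unfold D.
    assert (A1 : INR (length l) * (q * p / 2) <= 25 / 2 * p) by nra.
    assert (A2 : / (2 * (q * p)) * rsum l (fun n => c n ^ 2) <= K / 2 * p).
    { apply (Rmult_le_reg_l (2 * (q * p))); [lra | ].
      rewrite <- Rmult_assoc, Rinv_r, Rmult_1_l by lra.
      apply (Rle_trans _ _ _ S1). right; field. }
    lra.
Qed.

Lemma dyadic_ball (J : nat) : forall l : list (Z * Z), NoDup l ->
  (forall n, In n l -> (znorm n < 2 ^ Z.of_nat J)%Z) ->
  rsum l c <= c (0, 0)%Z + D * ((1 - r ^ J) / (1 - r)).
Proof.
  assert (HD : 0 <= D) by (unfold D; lra).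
  induction J as [ | J IH]; intros l Hl Hn.
  - simpl pow. replace ((1 - 1) / (1 - r)) with 0 by (field; lra).
    (* Norm below $2^0$ leaves the origin alone, which lies in no shell and gives the separate term
       [c (0, 0)]. *)
    assert (Z0 : forall n, In n l -> n = (0, 0)%Z).
    { intros [a b] Hin; specialize (Hn _ Hin); unfold znorm in Hn; simpl in Hn.
      f_equal; lia. }
    pose proof (c_ge_0 (0, 0)%Z) as C0.
    destruct Hl as [ | n l Hnl Hl]; simpl; [lra | ].
    destruct l as [ | m l].
    + rewrite (Z0 n) by (now left). simpl; lra.
    + elim Hnl. rewrite (Z0 n), (Z0 m) by (simpl; auto). now left.
  - set (p := fun n => Z.ltb (znorm n) (2 ^ Z.of_nat J)).
    rewrite (rsum_filter_split l p).
    assert (A1 := IH (filter p l) (NoDup_filter p Hl)).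
    assert (A2 := dyadic_shell J (filter (fun n => negb (p n)) l) (NoDup_filter _ Hl)).
    assert (B1 : rsum (filter p l) c <= c (0, 0)%Z + D * ((1 - r ^ J) / (1 - r))).
    { apply A1. intros n Hin. apply filter_In in Hin. apply Z.ltb_lt. apply Hin. }
    assert (B2 : rsum (filter (fun n => negb (p n)) l) c <= D * r ^ J).
    { apply A2. intros n Hin. apply filter_In in Hin. destruct Hin as [H1 H2]. split.
      - unfold p in H2. apply Bool.negb_true_iff, Z.ltb_ge in H2. exact H2.
      - now apply Hn. }
    replace ((1 - r ^ S J) / (1 - r)) with ((1 - r ^ J) / (1 - r) + r ^ J)
      by (simpl; field; lra).
    lra.
Qed.

Lemma dyadic_bounded : exists B, forall l, NoDup l -> rsum l c <= B.
Proof.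
  exists (c (0, 0)%Z + D * (1 / (1 - r))). intros l Hl.
  destruct (znorm_list_bound l) as [N HN].
  apply Rle_trans with (c (0, 0)%Z + D * ((1 - r ^ N) / (1 - r))).
  - apply dyadic_ball; auto. intros n Hin.
    (* As $N<2^N$, the norm bound [N] itself can serve as the dyadic exponent. *)
    apply Z.le_lt_trans with (Z.of_nat N); auto. apply Z.pow_gt_lin_r; lia.
  - apply Rplus_le_compat_l, Rmult_le_compat_l; [unfold D; lra | ].
    apply Rmult_le_compat_r; [left; apply Rinv_0_lt_compat; lra | ].
    assert (0 < r ^ N) by (apply pow_lt; lra). lra.
Qed.

End Dyadic.

(** Take [L] with partial sum within [eps] of the supremum; a list disjoint from it can add at most
    [eps]. *)
Lemma bounded_sums_tail (c : Z * Z -> R) (B : R) :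
  (forall l, NoDup l -> rsum l c <= B) ->
  forall eps, 0 < eps -> exists L, forall l, NoDup l ->
    (forall n, In n l -> ~ In n L) -> rsum l c <= eps.
Proof.
  intros HB eps He.
  destruct (completeness (fun s => exists l, NoDup l /\ s = rsum l c)) as [m [U M]].
  - exists B. intros s [l [Hl ->]]; auto.
  - exists 0, nil; split; [constructor | reflexivity].
  - assert (X : exists L, NoDup L /\ m - eps < rsum L c).
    { apply NNPP; intros N. assert (m <= m - eps); [ | lra].
      apply M. intros s [l [Hl ->]]. apply Rnot_lt_le; intros Hlt. apply N; now exists l. }
    destruct X as [L [HL HmL]]. exists L. intros l Hl Hd.
    assert (rsum (l ++ L) c <= m).
    { apply U. exists (l ++ L); split; auto. apply NoDup_app; auto. }
    rewrite rsum_app in H. lra.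
Qed.

(** * Unordered sums as suprema of finite sums *)

Lemma nnsum_le (a : Z * Z -> R) (P : Z * Z -> Prop) (B : R) :
  (forall l, NoDup l -> (forall n, In n l -> P n) -> rsum l a <= B) ->
  Rbar_le (nnsum a P) B.
Proof.
  intros H. unfold nnsum.
  apply Lub_Rbar_correct. intros s [l [Hl [HP ->]]].
  apply (H l Hl). now apply Forall_forall.
Qed.

(** The approximating list may depend on [eps], as it does in [fourier_error], where it is a growing
    box with [Om] removed. *)
Lemma nnsum_ge (a : Z * Z -> R) (P : Z * Z -> Prop) (v : R) :
  (forall eps, 0 < eps -> exists l, NoDup l /\ (forall n, In n l -> P n) /\ v <= rsum l a + eps) ->
  Rbar_le v (nnsum a P).
Proof.
  intros H.
  assert (U : forall l, NoDup l -> (forall n, In n l -> P n) -> Rbar_le (rsum l a) (nnsum a P)).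
  { intros l Hl HP. unfold nnsum.
    refine (proj1 (Lub_Rbar_correct _) _ _). exists l; repeat split; auto.
    now apply Forall_forall. }
  destruct (nnsum a P) as [s | | ] eqn:E; simpl; auto.
  - apply le_epsilon; intros eps He. destruct (H eps He) as [l [Hl [HP Hv]]].
    specialize (U l Hl HP); simpl in U. lra.
  - destruct (H 1 Rlt_0_1) as [l [Hl [HP _]]]. exact (U l Hl HP).
Qed.

(** * Fejer means *)

(** [dirichlet N] is $\sum_{|j|\le N}e^{ijt}$ and [fejer N] is $D_0+\dots+D_N$ before normalisation;
    the factor $1/(N+1)$ enters in [fkernel]. *)
Fixpoint dirichlet (N : nat) (t : R) : R :=
  match N with
  | O => 1
  | S N' => dirichlet N' t + 2 * cos (INR N * t)
  end.

Fixpoint fejer (N : nat) (t : R) : R :=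
  match N with
  | O => 1
  | S N' => fejer N' t + dirichlet N t
  end.

(** The factor $2-2\cos t=4\sin^2(t/2)$ stands in for the usual quotient by $\sin(t/2)$. The right
    side telescopes once more in [fejer_telescope], where positivity becomes visible. *)
Lemma dirichlet_telescope (N : nat) (t : R) :
  (2 - 2 * cos t) * dirichlet N t = 2 * cos (INR N * t) - 2 * cos ((INR N + 1) * t).
Proof.
  induction N as [ | N IH].
  - simpl. rewrite Rmult_0_l, cos_0, Rplus_0_l, Rmult_1_l; ring.
  - cbn [dirichlet]. rewrite Rmult_plus_distr_l, IH, S_INR.
    replace ((INR N + 1 + 1) * t) with ((INR N + 1) * t + t) by ring.
    replace (INR N * t) with ((INR N + 1) * t - t) by ring.
    rewrite cos_plus, cos_minus. ring.
Qed.

Lemma fejer_telescope (N : nat) (t : R) :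
  (2 - 2 * cos t) * fejer N t = 2 - 2 * cos ((INR N + 1) * t).
Proof.
  induction N as [ | N IH].
  - simpl. rewrite Rplus_0_l, Rmult_1_l; ring.
  - cbn [fejer]. rewrite Rmult_plus_distr_l, IH, dirichlet_telescope, S_INR. ring.
Qed.

Lemma cos_mult_1 (N : nat) (t : R) : cos t = 1 -> cos (INR N * t) = 1.
Proof.
  intros H.
  assert (S0 : sin t = 0).
  { pose proof (sin2_cos2 t) as E. rewrite H in E; unfold Rsqr in E. nra. }
  induction N as [ | N IH]; [now rewrite Rmult_0_l, cos_0 | ].
  rewrite S_INR, Rmult_plus_distr_r, Rmult_1_l, cos_plus, IH, H, S0. ring.
Qed.

Lemma fejer_ge_0 (N : nat) (t : R) : 0 <= fejer N t.
Proof.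
  pose proof (COS_bound t) as Ct.
  (* At $\cos t=1$ the telescoped identity reads $0=0$, but there all cosines in the kernel equal
     1. *)
  destruct (Req_dec (cos t) 1) as [H | H].
  - assert (D : forall M, 0 <= dirichlet M t).
    { induction M as [ | M IH]; cbn [dirichlet]; [lra | ].
      rewrite cos_mult_1 by assumption; lra. }
    induction N as [ | N IH]; cbn [fejer]; [lra | ]. specialize (D (S N)); lra.
  - pose proof (fejer_telescope N t) as E.
    pose proof (COS_bound ((INR N + 1) * t)).
    apply (Rmult_le_reg_l (2 - 2 * cos t)); lra.
Qed.

Lemma cis_opp_plus (a : R) : Cplus (cis a) (cis (- a)) = RtoC (2 * cos a).
Proof.
  unfold cis, Cplus, RtoC; simpl; rewrite cos_neg, sin_neg; f_equal; ring.
Qed.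

Lemma csum_dirichlet (N : nat) (t : R) :
  csum (zrange N) (fun j => cis (IZR j * t)) = RtoC (dirichlet N t).
Proof.
  induction N as [ | N IH].
  - simpl. rewrite Rmult_0_l, cis_0; ring.
  - cbn [zrange csum dirichlet]. rewrite IH, RtoC_plus, <- cis_opp_plus.
    rewrite opp_IZR, <- INR_IZR_INZ, Ropp_mult_distr_l_reverse. ring.
Qed.

(** Passing from $N$ to $N+1$ raises every old weight by 1 and gives the two new frequencies weight
    1, which in total adds $D_{N+1}$. *)
Lemma csum_fejer (N : nat) (t : R) :
  csum (zrange N) (fun j => Cmult (RtoC (INR N + 1 - IZR (Z.abs j))) (cis (IZR j * t)))
  = RtoC (fejer N t).
Proof.
  induction N as [ | N IH].
  - simpl. rewrite Rmult_0_l, cis_0, Rplus_0_l, Rminus_0_r; ring.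
  - cbn [fejer]. rewrite RtoC_plus, <- csum_dirichlet, <- IH.
    cbn [zrange csum].
    rewrite Z.abs_opp, Z.abs_eq, <- INR_IZR_INZ by lia.
    replace (INR (S N) + 1 - INR (S N)) with 1 by ring.
    rewrite (csum_ext_in _ _ (fun j => Cplus
       (Cmult (RtoC (INR N + 1 - IZR (Z.abs j))) (cis (IZR j * t))) (cis (IZR j * t)))).
    + rewrite csum_plus. ring.
    + intros j _. rewrite S_INR.
      replace (INR N + 1 + 1 - IZR (Z.abs j)) with (INR N + 1 - IZR (Z.abs j) + 1) by ring.
      rewrite RtoC_plus. ring.
Qed.

Definition fweight1 (N : nat) (j : Z) : R := 1 - IZR (Z.abs j) / (INR N + 1).

Definition fweight (N : nat) (n : Z * Z) : R :=
  fweight1 N (fst n) * fweight1 N (snd n).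

Definition fkernel (N : nat) (x y : R * R) : R :=
  fejer N (fst x - fst y) / (INR N + 1) * (fejer N (snd x - snd y) / (INR N + 1)).

Lemma csum_list_prod (l l' : list Z) (F G : Z -> C) :
  csum (list_prod l l') (fun n => Cmult (F (fst n)) (G (snd n)))
  = Cmult (csum l F) (csum l' G).
Proof.
  induction l as [ | a l IH]; simpl; [ring | ].
  rewrite csum_app, IH.
  replace (csum (map (fun y => (a, y)) l') (fun n => Cmult (F (fst n)) (G (snd n))))
    with (Cmult (F a) (csum l' G)); [ring | ].
  rewrite <- csum_scal. clear. induction l'; simpl; congruence.
Qed.

Lemma INR_1_pos (N : nat) : 0 < INR N + 1.
Proof. pose proof (pos_INR N); lra. Qed.

Lemma csum_fweight1 (N : nat) (t : R) :
  csum (zrange N) (fun j => Cmult (RtoC (fweight1 N j)) (cis (IZR j * t)))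
  = RtoC (fejer N t / (INR N + 1)).
Proof.
  unfold Rdiv. rewrite RtoC_mult, Cmult_comm, <- csum_fejer, <- csum_scal.
  apply csum_ext_in; intros j _. rewrite Cmult_assoc, <- RtoC_mult. do 2 f_equal.
  unfold fweight1. field. pose proof (INR_1_pos N); lra.
Qed.

Lemma csum_fweight (N : nat) (x y : R * R) :
  csum (zbox N) (fun n => Cmult (RtoC (fweight N n)) (Cmult (cis (ip n x)) (cis (- ip n y))))
  = RtoC (fkernel N x y).
Proof.
  unfold fkernel. rewrite RtoC_mult, <- !csum_fweight1, <- csum_list_prod.
  apply csum_ext_in; intros n _. unfold fweight.
  rewrite RtoC_mult, <- cis_plus.
  replace (ip n x + - ip n y) with
    (IZR (fst n) * (fst x - fst y) + IZR (snd n) * (snd x - snd y))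
    by (unfold ip; ring).
  rewrite cis_plus. ring.
Qed.

Lemma fkernel_ge_0 (N : nat) (x y : R * R) : 0 <= fkernel N x y.
Proof.
  pose proof (INR_1_pos N).
  apply Rmult_le_pos; apply Rmult_le_pos; try apply fejer_ge_0;
    left; now apply Rinv_0_lt_compat.
Qed.

Lemma cont_fkernel (N : nat) (x : R * R) : cont (fkernel N x).
Proof.
  apply (cont_ext (fun y => fst (csum (zbox N) (fun n =>
    Cmult (RtoC (fweight N n)) (Cmult (cis (ip n x)) (cis (- ip n y))))))).
  - intros y; now rewrite csum_fweight.
  - apply (ccont_csum (zbox N) (fun n y =>
      Cmult (RtoC (fweight N n)) (Cmult (cis (ip n x)) (cis (- ip n y))))).
    intros n; auto 10 with cont.
Qed.

Lemma ccont_RtoC (h : R * R -> R) : cont h -> ccont (fun x => RtoC (h x)).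
Proof. intros H; split; simpl; auto with cont. Qed.

#[local] Hint Resolve cont_fkernel ccont_RtoC : cont.

(** The kernel is a weighted sum of characters, so averaging [g] against it multiplies the
    coefficients by the weights. *)
Lemma fejer_mean (N : nat) (g : R * R -> C) (x : R * R) : ccont g ->
  cmean (fun y => Cmult (g y) (RtoC (fkernel N x y)))
  = csum (zbox N) (fun n => Cmult (RtoC (fweight N n)) (Cmult (fcoef g n) (cis (ip n x)))).
Proof.
  intros Hg.
  rewrite (cmean_ext _ (fun y => csum (zbox N) (fun n =>
    Cmult (Cmult (RtoC (fweight N n)) (cis (ip n x))) (Cmult (g y) (cis (- ip n y)))))).
  - rewrite cmean_csum by (intros; cbv beta; auto 10 with cont).
    apply csum_ext_in; intros n _. rewrite cmean_scal by auto with cont.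
    rewrite <- fcoef_cmean. ring.
  - intros y. rewrite <- csum_fweight, <- csum_scal.
    apply csum_ext_in; intros n _. ring.
Qed.

Lemma csum_single {A : Type} (l : list A) (m : A) (F : A -> C) :
  NoDup l -> In m l -> (forall n, In n l -> n <> m -> F n = RtoC 0) -> csum l F = F m.
Proof.
  induction 1 as [ | n l Hn Hl IH]; intros [] HF; simpl.
  - subst n. rewrite (csum_ext_in l F (fun _ => RtoC 0)), csum_0; [ring | ].
    intros n Hin; apply HF; [now right | ]. intros ->; contradiction.
  - rewrite IH, (HF n); [ring | now left | intros -> ; contradiction | assumption | ].
    intros k Hk; apply HF; now right.
Qed.

Lemma fejer_mean_cis (N : nat) (m : Z * Z) (x : R * R) : In m (zbox N) ->
  cmean (fun y => Cmult (cis (ip m y)) (RtoC (fkernel N x y)))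
  = Cmult (RtoC (fweight N m)) (cis (ip m x)).
Proof.
  intros Hm. rewrite (fejer_mean N (fun y => cis (ip m y))) by auto with cont.
  rewrite (csum_single _ m); auto using zbox_NoDup.
  - rewrite fcoef_cis. destruct (Zp_dec m m); [ring | congruence].
  - intros n _ Hn. rewrite fcoef_cis. destruct (Zp_dec m n); [congruence | ring].
Qed.

Lemma fweight_0 (N : nat) : fweight N (0, 0)%Z = 1.
Proof. unfold fweight, fweight1; simpl. field. pose proof (INR_1_pos N); lra. Qed.

Lemma mean_fkernel (N : nat) (x : R * R) : mean (fkernel N x) = 1.
Proof.
  assert (E := fejer_mean_cis N (0, 0)%Z x).
  rewrite fweight_0 in E.
  assert (Z0 : forall y, cis (ip (0, 0)%Z y) = RtoC 1).
  { intros y; rewrite <- cis_0; f_equal; unfold ip; simpl; ring. }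
  rewrite Z0 in E.
  rewrite (cmean_ext _ (fun y => RtoC (fkernel N x y))) in E
    by (intros y; rewrite Z0; ring).
  assert (F : fst (cmean (fun y => RtoC (fkernel N x y))) = 1).
  { rewrite E; [simpl; ring | ]. apply zbox_In; unfold znorm; simpl; lia. }
  exact F.
Qed.

(** The real part of [fejer_mean_cis], rotated by $e^{-i\langle m,x\rangle}$. The frequencies
    $(1,0)$ and $(0,1)$ give the Korovkin moments, both equal to $1/(N+1)$. *)
Lemma mean_fkernel_cos (N : nat) (m : Z * Z) (x : R * R) : In m (zbox N) ->
  mean (fun y => (1 - cos (ip m y - ip m x)) * fkernel N x y) = 1 - fweight N m.
Proof.
  intros Hm.
  rewrite (mean_ext _ (fun y => fkernel N x y - fst (Cmult (cis (- ip m x))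
     (Cmult (cis (ip m y)) (RtoC (fkernel N x y)))))).
  - rewrite mean_minus, mean_fkernel; auto with cont.
    + f_equal.
      change (fst (cmean (fun y => Cmult (cis (- ip m x))
        (Cmult (cis (ip m y)) (RtoC (fkernel N x y))))) = fweight N m).
      rewrite cmean_scal, fejer_mean_cis by auto with cont.
      rewrite Cmult_assoc, (Cmult_comm (cis _)), <- Cmult_assoc, <- cis_plus.
      rewrite Rplus_opp_l, cis_0. simpl; ring.
    + apply (ccont_mult (fun _ => cis (- ip m x))); auto with cont.
  - intros y. rewrite Cmult_assoc, <- cis_plus. simpl.
    rewrite (Rplus_comm (- ip m x)). unfold Rminus. ring.
Qed.

(** Uniform continuity on the torus in a form that can be integrated against the kernel: [K] depends
    on [eps] but not on [x], and the error terms are periodic test functions vanishing at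
    [y = x]. *)
Definition korovkin (g : R * R -> C) : Prop :=
  forall eps, 0 < eps -> exists K, 0 <= K /\ forall x y,
    Cmod (Cminus (g y) (g x))
    <= eps + K * ((1 - cos (fst y - fst x)) + (1 - cos (snd y - snd x))).

(** The hypothesis is averaged against a nonnegative kernel of mean 1; the two moments produce
    $2K/(N+1)$. The frequencies $(1,0)$ and $(0,1)$ lie in the box only from $N=1$ on. *)
Lemma fejer_mean_error (g : R * R -> C) (x : R * R) (eps K : R) (N : nat) :
  ccont g -> (1 <= N)%nat ->
  (forall y, Cmod (Cminus (g y) (g x))
     <= eps + K * ((1 - cos (fst y - fst x)) + (1 - cos (snd y - snd x)))) ->
  Cmod (Cminus (g x)
    (csum (zbox N) (fun n => Cmult (RtoC (fweight N n)) (Cmult (fcoef g n) (cis (ip n x))))))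
  <= eps + 2 * K / (INR N + 1).
Proof.
  intros Hg HN HK. rewrite <- fejer_mean by assumption.
  assert (E1 : mean (fun y => (1 - cos (fst y - fst x)) * fkernel N x y) = 1 / (INR N + 1)).
  { rewrite (mean_ext _ (fun y => (1 - cos (ip (1, 0)%Z y - ip (1, 0)%Z x)) * fkernel N x y)).
    - rewrite mean_fkernel_cos.
      + unfold fweight, fweight1; simpl. field. pose proof (INR_1_pos N); lra.
      + apply zbox_In; unfold znorm; simpl; lia.
    - intros y; do 3 f_equal; unfold ip; simpl; ring. }
  assert (E2 : mean (fun y => (1 - cos (snd y - snd x)) * fkernel N x y) = 1 / (INR N + 1)).
  { rewrite (mean_ext _ (fun y => (1 - cos (ip (0, 1)%Z y - ip (0, 1)%Z x)) * fkernel N x y)).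
    - rewrite mean_fkernel_cos.
      + unfold fweight, fweight1; simpl. field. pose proof (INR_1_pos N); lra.
      + apply zbox_In; unfold znorm; simpl; lia.
    - intros y; do 3 f_equal; unfold ip; simpl; ring. }
  replace (Cminus (g x) (cmean (fun y => Cmult (g y) (RtoC (fkernel N x y)))))
    with (Copp (cmean (fun y => Cmult (Cminus (g y) (g x)) (RtoC (fkernel N x y))))).
  2:{ rewrite (cmean_ext _ (fun y => Cminus (Cmult (g y) (RtoC (fkernel N x y)))
         (Cmult (g x) (RtoC (fkernel N x y))))) by (intros; ring).
      rewrite cmean_minus, cmean_scal by auto with cont.
      replace (cmean (fun y => RtoC (fkernel N x y))) with (RtoC 1); [ring | ].
      unfold cmean, RtoC; simpl. change (1, 0) with (RtoC 1).
      rewrite mean_const. now rewrite (mean_ext _ (fkernel N x)), mean_fkernel. }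
  rewrite Cmod_opp.
  replace (eps + 2 * K / (INR N + 1)) with (mean (fun y => eps * fkernel N x y +
     K * ((1 - cos (fst y - fst x)) * fkernel N x y + (1 - cos (snd y - snd x)) * fkernel N x y))).
  - apply Cmod_cmean_le; auto 10 with cont.
    intros y. rewrite Cmod_mult, Cmod_R, Rabs_pos_eq by apply fkernel_ge_0.
    pose proof (fkernel_ge_0 N x y) as F.
    eapply Rle_trans; [apply Rmult_le_compat_r; [exact F | apply HK] | ].
    right; ring.
  - rewrite mean_plus, !mean_scal, mean_plus, E1, E2, mean_fkernel; auto 10 with cont.
    unfold Rdiv; ring.
Qed.

Definition inb (l : list (Z * Z)) (n : Z * Z) : bool :=
  if in_dec Zp_dec n l then true else false.

Lemma inb_true (l : list (Z * Z)) (n : Z * Z) : inb l n = true <-> In n l.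
Proof. unfold inb; destruct (in_dec Zp_dec n l); split; auto; discriminate. Qed.

(** With $u,v\in[0,1]$ the one-dimensional defects, $1-(1-u)(1-v)\le u+v$, and each defect is at
    most $L/(N+1)$. *)
Lemma fweight_bound (N L : nat) (n : Z * Z) :
  (L <= N)%nat -> (znorm n <= Z.of_nat L)%Z ->
  0 <= 1 - fweight N n <= 2 * INR L / (INR N + 1).
Proof.
  intros HL Hn. pose proof (INR_1_pos N) as HN. apply le_INR in HL.
  assert (W : forall j, (Z.abs j <= Z.of_nat L)%Z ->
            0 <= 1 - fweight1 N j <= INR L / (INR N + 1) /\ 0 <= fweight1 N j).
  { intros j Hj. apply IZR_le in Hj. rewrite <- INR_IZR_INZ in Hj.
    assert (0 <= IZR (Z.abs j)) by (apply IZR_le; lia).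
    assert (P : 0 < / (INR N + 1)) by now apply Rinv_0_lt_compat.
    assert (Q : INR N * / (INR N + 1) <= 1).
    { apply (Rmult_le_reg_r (INR N + 1)); [lra | ]. field_simplify; lra. }
    unfold fweight1, Rdiv. split; [split | ]; nra. }
  unfold znorm in Hn.
  destruct (W (fst n)) as [[A1 A2] A3]; [lia | ].
  destruct (W (snd n)) as [[B1 B2] B3]; [lia | ].
  unfold fweight. replace (2 * INR L / (INR N + 1)) with (INR L / (INR N + 1) + INR L / (INR N + 1)) by (unfold Rdiv; ring).
  nra.
Qed.

Lemma nat_large (v eps : R) : 0 < eps -> exists N0, forall N, (N0 <= N)%nat -> v / (INR N + 1) <= eps.
Proof.
  intros He. destruct (nfloor_ex (Rabs v / eps)) as [N0 HN0].
  { apply Rmult_le_pos; [apply Rabs_pos | left; now apply Rinv_0_lt_compat]. }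
  exists N0. intros N HN. apply le_INR in HN. pose proof (INR_1_pos N).
  apply (Rmult_le_reg_r (INR N + 1)); [lra | ].
  unfold Rdiv; rewrite Rmult_assoc, Rinv_l, Rmult_1_r by lra.
  apply Rle_trans with (Rabs v); [apply Rle_abs | ].
  replace (Rabs v) with (eps * (Rabs v / eps)) by (field; lra).
  apply Rmult_le_compat_l; lra.
Qed.

(** Insert the Fejer mean [sig]. In [sig] minus the partial sum, frequencies outside [Om] carry
    weights in $[0,1]$ and are paid for by the right-hand side; those in [Om] carry the defect
    $1-w_n$, which tends to 0. *)
Lemma fourier_error (g : R * R -> C) (Om : list (Z * Z)) (x : R * R) :
  ccont g -> korovkin g -> NoDup Om ->
  Rbar_le (Cmod (Cminus (g x) (FOmega Om g x)))
          (nnsum (fun n => Cmod (fcoef g n)) (fun n => ~ In n Om)).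
Proof.
  intros Hg Kg HOm. apply nnsum_ge. intros eps He.
  destruct (Kg (eps / 2)) as [K [HK0 HK]]; [lra | ].
  destruct (znorm_list_bound Om) as [L HL].
  set (s := rsum Om (fun n => Cmod (fcoef g n))).
  (* The Fejer error beyond [eps / 2] and the weight defects on [Om] are both of order $1/(N+1)$ and
     share the other [eps / 2]. *)
  destruct (nat_large (2 * K + 2 * INR L * s) (eps / 2)) as [N0 HN0]; [lra | ].
  (* [N0] makes the errors small, [L] puts [Om] inside the box, and 1 serves [fejer_mean_error]. *)
  set (N := (N0 + L + 1)%nat).
  specialize (HN0 N ltac:(lia)).
  exists (filter (fun n => negb (inb Om n)) (zbox N)).
  split; [apply NoDup_filter, zbox_NoDup | ]. split.
  { intros n Hn HO. apply filter_In in Hn. destruct Hn as [_ Hn].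
    apply inb_true in HO. rewrite HO in Hn; discriminate. }
  assert (E1 := fejer_mean_error g x (eps / 2) K N Hg ltac:(lia) (HK x)).
  set (sig := csum (zbox N) _) in E1.
  assert (PO : Permutation Om (filter (inb Om) (zbox N))).
  { apply NoDup_Permutation; auto using NoDup_filter, zbox_NoDup.
    intros n; rewrite filter_In, inb_true, zbox_In. split; [ | tauto].
    intros Hn; split; auto. specialize (HL n Hn). lia. }
  assert (E2 : Cmod (Cminus sig (FOmega Om g x)) <=
     rsum (filter (fun n => negb (inb Om n)) (zbox N)) (fun n => Cmod (fcoef g n))
     + 2 * INR L * s / (INR N + 1)).
  { unfold FOmega. rewrite (csum_permutation _ _ _ PO), csum_filter.
    replace (Cminus sig _) with (csum (zbox N) (fun n =>
       Cmult (RtoC (fweight N n - (if inb Om n then 1 else 0))) (Cmult (fcoef g n) (cis (ip n x))))).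
    2:{ rewrite (csum_ext_in _ _ (fun n => Cplus
          (Cmult (RtoC (fweight N n)) (Cmult (fcoef g n) (cis (ip n x))))
          (Cmult (Copp (RtoC 1))
             (if inb Om n then Cmult (fcoef g n) (cis (ip n x)) else RtoC 0)))).
        - rewrite csum_plus, csum_scal. fold sig. ring.
        - intros n _. rewrite RtoC_minus. destruct (inb Om n); ring. }
    eapply Rle_trans; [apply Cmod_csum_le | ].
    rewrite (rsum_filter_split _ (inb Om)), Rplus_comm.
    apply Rplus_le_compat.
    - apply rsum_le; intros n Hn. apply filter_In in Hn. destruct Hn as [Hn Hb].
      destruct (inb Om n); [discriminate | ].
      rewrite !Cmod_mult, Cmod_cis, Cmod_R, Rmult_1_r, Rminus_0_r.
      rewrite <- (Rmult_1_l (Cmod (fcoef g n))) at 2.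
      apply Rmult_le_compat_r; [apply Cmod_ge_0 | ].
      apply zbox_In in Hn.
      assert (Wn := fweight_bound N N n (le_n N) Hn).
      assert (W0 : 0 <= fweight N n).
      { assert (W1 : forall j, (Z.abs j <= Z.of_nat N)%Z -> 0 <= fweight1 N j).
        { intros j Hj; apply IZR_le in Hj. rewrite <- INR_IZR_INZ in Hj.
          unfold fweight1. pose proof (INR_1_pos N).
          apply (Rmult_le_reg_r (INR N + 1)); [lra | ]. field_simplify; lra. }
        unfold znorm in Hn. apply Rmult_le_pos; apply W1; lia. }
      rewrite Rabs_pos_eq; lra.
    - rewrite <- (rsum_permutation _ _ _ PO).
      replace (2 * INR L * s / (INR N + 1)) with (2 * INR L / (INR N + 1) * s) by (unfold Rdiv; ring).
      unfold s; rewrite <- rsum_scal. apply rsum_le; intros n Hn.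
      rewrite (proj2 (inb_true Om n) Hn).
      rewrite !Cmod_mult, Cmod_cis, Cmod_R, Rmult_1_r.
      apply Rmult_le_compat_r; [apply Cmod_ge_0 | ].
      destruct (fweight_bound N L n ltac:(lia) (HL n Hn)).
      rewrite Rabs_minus_sym, Rabs_pos_eq; lra. }
  replace (Cminus (g x) (FOmega Om g x))
    with (Cplus (Cminus (g x) sig) (Cminus sig (FOmega Om g x))) by ring.
  eapply Rle_trans; [apply Cmod_triangle | ].
  unfold Rdiv in *. lra.
Qed.

(** Once the expanding sets contain the finite list [L] of [bounded_sums_tail], the bound of
    [fourier_error] is at most [eps] for all [x]. *)
Lemma fourier_uniform (g : R * R -> C) (B : R) (Oms : nat -> list (Z * Z)) :
  ccont g -> korovkin g ->
  (forall l, NoDup l -> rsum l (fun n => Cmod (fcoef g n)) <= B) ->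
  (forall h, NoDup (Oms h)) ->
  (forall h, incl (Oms h) (Oms (S h))) ->
  (forall n, exists h, In n (Oms h)) ->
  forall eps, 0 < eps -> exists H, forall h, (H <= h)%nat -> forall x,
    Cmod (Cminus (g x) (FOmega (Oms h) g x)) <= eps.
Proof.
  intros Hg Kg HB HN HI HE eps He.
  destruct (bounded_sums_tail _ B HB eps He) as [L HL].
  assert (M : forall h h', (h <= h')%nat -> incl (Oms h) (Oms h')).
  { induction 1; [apply incl_refl | ]. eapply incl_tran; eauto. }
  assert (X : exists H, incl L (Oms H)).
  { clear - M HE. induction L as [ | n L [H IH]].
    - exists 0%nat; intros n [].
    - destruct (HE n) as [h Hh]. exists (H + h)%nat. apply incl_cons.
      + apply (M h); [lia | assumption].
      + eapply incl_tran; [exact IH | apply M; lia]. }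
  destruct X as [H HLH]. exists H. intros h Hh x.
  assert (E := fourier_error g (Oms h) x Hg Kg (HN h)).
  assert (F : Rbar_le (nnsum (fun n => Cmod (fcoef g n)) (fun n => ~ In n (Oms h))) eps).
  { apply nnsum_le. intros l Hl HP. apply HL; auto.
    intros n Hn HnL. apply (HP n Hn), (M H h Hh), HLH, HnL. }
  exact (Rbar_le_trans _ _ _ E F).
Qed.

(** * The double Fourier sphere parametrisation *)

Lemma phi_on_sphere (x : R * R) : on_sphere (phi x).
Proof.
  unfold on_sphere, phi, p1, p2, p3; simpl.
  pose proof (sin2_cos2 (fst x)) as E1; pose proof (sin2_cos2 (snd x)) as E2.
  unfold Rsqr in *.
  replace (cos (fst x) * sin (snd x) * (cos (fst x) * sin (snd x) * 1)
    + sin (fst x) * sin (snd x) * (sin (fst x) * sin (snd x) * 1)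
    + cos (snd x) * (cos (snd x) * 1))
  with ((sin (fst x) * sin (fst x) + cos (fst x) * cos (fst x)) * (sin (snd x) * sin (snd x))
    + cos (snd x) * cos (snd x)) by ring.
  rewrite E1; lra.
Qed.

Lemma angle_exists (u v : R) : u ^ 2 + v ^ 2 = 1 ->
  exists t, - PI <= t < PI /\ cos t = u /\ sin t = v.
Proof.
  intros H. pose proof PI_RGT_0 as P.
  assert (Hu : -1 <= u <= 1) by nra.
  pose proof (acos_bound u) as Ab.
  assert (Ec : cos (acos u) = u) by now apply cos_acos.
  assert (Es : sin (acos u) = Rabs v).
  { rewrite sin_acos by assumption. rewrite <- sqrt_Rsqr_abs. f_equal. unfold Rsqr; lra. }
  destruct (Rle_dec 0 v) as [Hv | Hv].
  - rewrite Rabs_pos_eq in Es by assumption.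
    (* The interval is half-open, so the angle $\pi$ is replaced by $-\pi$. *)
    destruct (Req_dec (acos u) PI) as [E | E].
    + rewrite E in Ec, Es. rewrite cos_PI in Ec; rewrite sin_PI in Es.
      exists (- PI). rewrite cos_neg, sin_neg, cos_PI, sin_PI. repeat split; lra.
    + exists (acos u). repeat split; lra.
  - rewrite Rabs_left in Es by lra.
    assert (acos u <> 0).
    { intros E. rewrite E, sin_0 in Es. lra. }
    exists (- acos u). rewrite cos_neg, sin_neg. repeat split; lra.
Qed.

Lemma phi_surjective (xi : R3) : on_sphere xi -> exists p, phi_dom p /\ phi p = xi.
Proof.
  destruct xi as [[x y] z]; unfold on_sphere, p1, p2, p3; simpl fst; simpl snd; intros H.
  assert (Hz : -1 <= z <= 1) by nra.
  (* [phi_dom] has a single point over each pole, where division by $\sin\theta$ is impossible. *)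
  destruct (Req_dec z 1) as [-> | Z1].
  { exists (0, 0). split; [right; now left | ].
    unfold phi; simpl. rewrite sin_0, cos_0. repeat f_equal; nra. }
  destruct (Req_dec z (-1)) as [-> | Z2].
  { exists (0, PI). split; [right; now right | ].
    unfold phi; simpl. rewrite sin_PI, cos_PI. repeat f_equal; nra. }
  set (s := sqrt (1 - z ^ 2)).
  assert (Hs : 0 < s) by (apply sqrt_lt_R0; nra).
  assert (Es : s ^ 2 = 1 - z ^ 2) by (apply pow2_sqrt; nra).
  destruct (angle_exists (x / s) (y / s)) as [t [Ht [Ec Esn]]].
  { replace ((x / s) ^ 2 + (y / s) ^ 2) with ((x ^ 2 + y ^ 2) / s ^ 2) by (field; lra).
    rewrite Es. replace (x ^ 2 + y ^ 2) with (1 - z ^ 2) by lra. field. nra. }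
  exists (t, acos z). split.
  - left; simpl. split; auto. apply acos_bound_lt; lra.
  - unfold phi; simpl. rewrite Ec, Esn, cos_acos, sin_acos by assumption.
    replace (1 - Rsqr z) with (1 - z ^ 2) by (unfold Rsqr; ring). fold s.
    repeat f_equal; field; lra.
Qed.

Lemma phi_phi_inv (xi : R3) : on_sphere xi -> phi (phi_inv xi) = xi.
Proof.
  intros H. apply (epsilon_spec (inhabits (0, 0)) (fun p => phi_dom p /\ phi p = xi)).
  now apply phi_surjective.
Qed.

Lemma cos_diff_bound (a b : R) : Rabs (cos a - cos b) <= 2 * Rabs (sin ((a - b) / 2)).
Proof.
  rewrite form2, !Rabs_mult, Rabs_left by lra.
  pose proof (Rabs_pos (sin ((a - b) / 2))).
  assert (Rabs (sin ((a + b) / 2)) <= 1) by (apply Rabs_le, SIN_bound). nra.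
Qed.

Lemma sin_diff_bound (a b : R) : Rabs (sin a - sin b) <= 2 * Rabs (sin ((a - b) / 2)).
Proof.
  rewrite form4, !Rabs_mult, Rabs_pos_eq by lra.
  pose proof (Rabs_pos (sin ((a - b) / 2))).
  assert (Rabs (cos ((a + b) / 2)) <= 1) by (apply Rabs_le, COS_bound). nra.
Qed.

Lemma Rabs_sin_le (t : R) : Rabs (sin t) <= Rabs t.
Proof.
  assert (P : forall s, 0 <= s -> Rabs (sin s) <= s).
  { intros s [Hs | <-]; [ | rewrite sin_0, Rabs_R0; lra].
    assert (H1 := sin_lt_x s Hs).
    apply Rabs_le; split; [ | lra].
    destruct (Rle_dec s PI) as [L | L].
    - pose proof (sin_ge_0 s ltac:(lra) L). lra.
    - pose proof (SIN_bound s). pose proof PI2_1. lra. }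
  destruct (Rle_dec 0 t) as [H | H].
  - rewrite (Rabs_pos_eq t) by assumption. auto.
  - rewrite (Rabs_left t), <- (Rabs_Ropp (sin t)), <- sin_neg by lra. apply P; lra.
Qed.

Lemma half_angle (t : R) : 1 - cos t = 2 * Rabs (sin (t / 2)) ^ 2.
Proof.
  rewrite <- Rsqr_pow2, <- Rsqr_abs. unfold Rsqr.
  replace t with (2 * (t / 2)) at 1 by field. rewrite cos_2a_sin. ring.
Qed.

(** A closed cube in place of a ball: replacing coordinates of its centre by those of another of its
    points stays inside. *)
Definition near (r : R) (p q : R3) : Prop :=
  Rabs (p1 q - p1 p) <= r /\ Rabs (p2 q - p2 p) <= r /\ Rabs (p3 q - p3 p) <= r.

Lemma dist3_near (r : R) (p q : R3) : near r p q -> dist3 p q <= 3 * r /\ dist3 q p <= 3 * r.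
Proof.
  intros [H1 [H2 H3]]. assert (0 <= r) by (pose proof (Rabs_pos (p1 q - p1 p)); lra).
  apply Rabs_le_between in H1, H2, H3.
  unfold dist3. split; rewrite <- (sqrt_pow2 (3 * r)) by lra; apply sqrt_le_1_alt; nra.
Qed.

(** The half-angle sines serve twice: their squares are $(1-\cos)/2$, as [korovkin] wants, and they
    are at most half the angle, as small shifts want. *)
Lemma phi_near (x y : R * R) :
  near (2 * (Rabs (sin ((fst y - fst x) / 2)) + Rabs (sin ((snd y - snd x) / 2)))) (phi x) (phi y).
Proof.
  set (s1 := Rabs (sin ((fst y - fst x) / 2))).
  set (s2 := Rabs (sin ((snd y - snd x) / 2))).
  assert (0 <= s1) by apply Rabs_pos. assert (0 <= s2) by apply Rabs_pos.
  assert (P : forall a b a' b', Rabs (a - a') <= 2 * s1 -> Rabs (b - b') <= 2 * s2 ->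
            -1 <= b <= 1 -> -1 <= a' <= 1 -> Rabs (a * b - a' * b') <= 2 * (s1 + s2)).
  { intros a b a' b' Ha Hb B A.
    replace (a * b - a' * b') with ((a - a') * b + a' * (b - b')) by ring.
    eapply Rle_trans; [apply Rabs_triang | ]. rewrite !Rabs_mult.
    assert (Rabs b <= 1) by (apply Rabs_le; lra).
    assert (Rabs a' <= 1) by (apply Rabs_le; lra).
    pose proof (Rabs_pos (a - a')); pose proof (Rabs_pos (b - b')).
    pose proof (Rabs_pos b); pose proof (Rabs_pos a'). nra. }
  unfold near, phi, p1, p2, p3; simpl. repeat split.
  - apply P; auto using cos_diff_bound, sin_diff_bound, SIN_bound, COS_bound.
  - apply P; auto using sin_diff_bound, SIN_bound.
  - pose proof (cos_diff_bound (snd y) (snd x)). unfold s2 in *. lra.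
Qed.

Lemma Rabs_sin_half_le (t : R) : 2 * Rabs (sin (t / 2)) <= Rabs t.
Proof.
  pose proof (Rabs_sin_le (t / 2)) as H. unfold Rdiv in H at 2.
  rewrite Rabs_mult, (Rabs_pos_eq (/ 2)) in H by lra. lra.
Qed.

Lemma near_le (r r' : R) (p q : R3) : r <= r' -> near r p q -> near r' p q.
Proof. intros H [A [B D]]; repeat split; lra. Qed.

Lemma near_trans (r r' : R) (p q s : R3) : near r p q -> near r' q s -> near (r + r') p s.
Proof.
  intros [A1 [A2 A3]] [B1 [B2 B3]].
  apply Rabs_le_between in A1, A2, A3, B1, B2, B3.
  repeat split; apply Rabs_le; lra.
Qed.

(** A Lebesgue number argument for the sphere, with compactness taken from the parameter rectangle
    $[-\pi,\pi]\times[0,\pi]$. It provides one radius on which Taylor expansions are possible at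
    every point. *)
Lemma sphere_tube (U : R3 -> Prop) :
  open3 U -> (forall x, on_sphere x -> U x) ->
  exists d, 0 < d /\ forall p q, on_sphere p -> near d p q -> U q.
Proof.
  intros HU HS.
  (* Parameters within [r] and a cube of side at most [r] add up to [near (3 * r)], hence distance
     at most [9 * r]; 12 leaves a strict margin. *)
  assert (R0 : forall u v, exists r : posreal, forall y, dist3 (phi (u, v)) y < 12 * r -> U y).
  { intros u v. destruct (HU (phi (u, v)) (HS _ (phi_on_sphere _))) as [r [Hr H]].
    assert (P : 0 < r / 12) by lra. exists (mkposreal _ P). intros y Hy; apply H.
    simpl in Hy. lra. }
  set (delta := fun u v => proj1_sig (constructive_indefinite_description _ (R0 u v))).
  destruct (compactness_value_2d (- PI) PI 0 PI delta) as [d Hd].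
  exists (d : R). split; [apply cond_pos | ]. intros p q Hp Hq.
  destruct (phi_surjective p Hp) as [[x y] [Hdom Hpq]].
  assert (Hx : - PI <= x <= PI /\ 0 <= y <= PI).
  { pose proof PI_RGT_0. destruct Hdom as [[A B] | [E | E]]; simpl in *;
      try (injection E as -> ->); lra. }
  (* [compactness_value_2d] concludes with a double negation. *)
  apply NNPP; intros HnU. apply (Hd x y); try tauto.
  intros [u [v [_ [_ [Hu [Hv Hduv]]]]]]. apply HnU.
  revert Hu Hv Hduv. unfold delta.
  destruct (constructive_indefinite_description _ (R0 u v)) as [r Hr]; simpl.
  intros Hu Hv Hduv. apply Hr.
  assert (N : near (3 * r) (phi (u, v)) q).
  { apply near_le with (2 * r + d); [lra | ]. apply near_trans with p; auto.
    rewrite <- Hpq. eapply near_le; [ | apply phi_near]. simpl.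
    pose proof (Rabs_sin_half_le (x - u)). pose proof (Rabs_sin_half_le (y - v)). lra. }
  apply dist3_near in N. pose proof (cond_pos r). lra.
Qed.

Lemma korovkin_dfs (f : R3 -> C) (B : R) :
  (forall p, on_sphere p -> Cmod (f p) <= B) -> unif_cont_on on_sphere f -> korovkin (dfs f).
Proof.
  intros HB HU eps He.
  destruct (HU eps He) as [d [Hd H]].
  assert (B0 : 0 <= B).
  { eapply Rle_trans; [apply Cmod_ge_0 | apply (HB (phi (0, 0))), phi_on_sphere]. }
  (* Far points satisfy $d\le6(s_1+s_2)$, so $d^2\le36(2s_1^2+2s_2^2)$; the trivial bound $2B$ is
     then at most $72B/d^2$ times the sum of the two $1-\cos$. *)
  exists (72 * B / d ^ 2). split.
  { apply Rmult_le_pos; [lra | left; apply Rinv_0_lt_compat, pow_lt; lra]. }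
  intros x y. unfold dfs. rewrite !half_angle.
  pose proof (phi_near x y) as N. apply dist3_near in N. destruct N as [_ N].
  set (s1 := Rabs (sin ((fst y - fst x) / 2))) in *.
  set (s2 := Rabs (sin ((snd y - snd x) / 2))) in *.
  assert (0 <= s1) by apply Rabs_pos. assert (0 <= s2) by apply Rabs_pos.
  assert (Q : 0 <= 72 * B / d ^ 2).
  { apply Rmult_le_pos; [lra | left; apply Rinv_0_lt_compat, pow_lt; lra]. }
  destruct (Rlt_dec (dist3 (phi y) (phi x)) d) as [L | L].
  - specialize (H (phi y) (phi x) (phi_on_sphere y) (phi_on_sphere x) L).
    pose proof (pow2_ge_0 s1). pose proof (pow2_ge_0 s2). nra.
  - apply Rle_trans with (2 * B).
    + unfold Cminus. eapply Rle_trans; [apply Cmod_triangle | ]. rewrite Cmod_opp.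
      pose proof (HB _ (phi_on_sphere x)). pose proof (HB _ (phi_on_sphere y)). lra.
    + assert (D : d <= 6 * (s1 + s2)) by lra.
      assert (D2 : d ^ 2 <= 36 * (2 * s1 ^ 2 + 2 * s2 ^ 2)).
      { apply Rle_trans with ((6 * (s1 + s2)) ^ 2); [apply pow_incr; lra | ].
        pose proof (pow2_ge_0 (s1 - s2)). nra. }
      assert (Pd : 0 < d ^ 2) by (apply pow_lt; lra).
      apply Rle_trans with (72 * B / d ^ 2 * (2 * s1 ^ 2 + 2 * s2 ^ 2)); [ | lra].
      apply (Rmult_le_reg_r (d ^ 2)); [assumption | ].
      replace (72 * B / d ^ 2 * (2 * s1 ^ 2 + 2 * s2 ^ 2) * d ^ 2)
        with (2 * B * (36 * (2 * s1 ^ 2 + 2 * s2 ^ 2))) by (field; lra).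
      apply Rmult_le_compat_l; lra.
Qed.

(** The majorant [q] is continuous and equals [eps / 2] at [x], so it stays below [eps] nearby. *)
Lemma korovkin_ccont (g : R * R -> C) : korovkin g -> ccont g.
Proof.
  intros H.
  assert (X : forall u : R * R -> R, (forall x y, Rabs (u y - u x) <= Cmod (Cminus (g y) (g x))) -> cont u).
  { intros u Hu x. apply filterlim_locally. intros eps.
    destruct (H (eps / 2)) as [K [HK Hg]]; [pose proof (cond_pos eps); lra | ].
    set (q := fun y : R * R => eps / 2 + K * ((1 - cos (fst y - fst x)) + (1 - cos (snd y - snd x)))).
    assert (Cq : cont q) by (unfold q; auto 10 with cont).
    assert (He : 0 < eps / 2) by (pose proof (cond_pos eps); lra).
    assert (L := proj1 (filterlim_locally q (q x)) (Cq x) (mkposreal _ He)).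
    refine (filter_imp _ _ _ L). intros y Hy.
    change (Rabs (q y - q x) < eps / 2) in Hy. change (Rabs (u y - u x) < eps).
    apply Rabs_def2 in Hy.
    assert (Ex : q x = eps / 2).
    { unfold q. rewrite !(Rminus_diag_eq _ _ eq_refl), cos_0. ring. }
    apply Rle_lt_trans with (q y); [exact (Rle_trans _ _ _ (Hu x y) (Hg x y)) | ].
    rewrite Ex in Hy; lra. }
  split; apply X; intros x y.
  - exact (Rle_trans _ _ _ (Rmax_l _ _) (Rmax_Cmod (Cminus (g y) (g x)))).
  - exact (Rle_trans _ _ _ (Rmax_r _ _) (Rmax_Cmod (Cminus (g y) (g x)))).
Qed.

Lemma cperiodic_dfs (f : R3 -> C) : cperiodic (dfs f).
Proof.
  assert (H : forall x y, phi (x + 2 * PI, y) = phi (x, y) /\ phi (x, y + 2 * PI) = phi (x, y)).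
  { intros x y; unfold phi; simpl.
    rewrite !cos_plus, !sin_plus, cos_2PI, sin_2PI. split; repeat f_equal; ring. }
  split; intros x y; destruct (H x y) as [A B]; unfold dfs; now rewrite A, B.
Qed.

(** * Second differences of the DFS function *)

(** [dpart] differentiates a shifted function at 0, while the mean value theorem works along a
    coordinate line. *)
Lemma is_derive_translate (h : R -> R) (x l : R) :
  is_derive (fun t => h (x + t)) 0 l -> is_derive h x l.
Proof.
  intros H.
  apply (is_derive_ext (fun y => (fun t => h (x + t)) (y - x))).
  { intros t; f_equal; ring. }
  replace l with (scal 1 l) by (unfold scal; simpl; unfold mult; simpl; ring).
  apply (is_derive_comp (fun t => h (x + t)) (fun y => y - x)).
  - now replace (x - x) with 0 by ring.
  - auto_derive; auto.
Qed.

Lemma mvt_near (h dh : R -> R) (a b r : R) :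
  (forall t, Rabs (t - a) <= r -> is_derive h t (dh t)) -> Rabs (b - a) <= r ->
  exists c, Rabs (c - a) <= r /\ h b - h a = dh c * (b - a).
Proof.
  intros H Hb. apply Rabs_le_between in Hb.
  assert (B : forall t, Rmin a b <= t <= Rmax a b -> Rabs (t - a) <= r).
  { intros t Ht. apply Rabs_le. revert Ht.
    unfold Rmin, Rmax; destruct (Rle_dec a b); lra. }
  destruct (MVT_gen h a b dh) as [c [Hc E]].
  - intros t Ht; apply H, B; lra.
  - intros t Ht. apply continuity_pt_filterlim.
    apply (ex_derive_continuous h). exists (dh t). apply H, B, Ht.
  - exists c; split; auto.
Qed.

Lemma near_intro (r a b c a' b' c' : R) :
  Rabs (a' - a) <= r -> Rabs (b' - b) <= r -> Rabs (c' - c) <= r ->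
  near r (a, b, c) (a', b', c').
Proof. repeat split; assumption. Qed.

Lemma Rabs_diag_le (a r : R) : 0 <= r -> Rabs (a - a) <= r.
Proof. intros; now rewrite Rminus_diag_eq, Rabs_R0. Qed.

(* The coordinates are changed one at a time in the order 0, 1, 2, because Dbeta only
   provides the mixed derivatives D_j D_i with j <= i. *)
Lemma taylor1 (u : R3 -> R) (G : nat -> R3 -> R) (p q : R3) (r eta : R) :
  near r p q ->
  (forall i z, (i < 3)%nat -> near r p z -> is_derive (fun t => u (Defs.shift z i t)) 0 (G i z)) ->
  (forall a, near r p (a, p2 p, p3 p) -> Rabs (G 0%nat (a, p2 p, p3 p) - G 0%nat p) <= eta) ->
  (forall a b, near r p (a, b, p3 p) -> Rabs (G 1%nat (a, b, p3 p) - G 1%nat p) <= eta) ->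
  (forall a b c, near r p (a, b, c) -> Rabs (G 2%nat (a, b, c) - G 2%nat p) <= eta) ->
  Rabs (u q - u p - (G 0%nat p * (p1 q - p1 p) + G 1%nat p * (p2 q - p2 p)
                     + G 2%nat p * (p3 q - p3 p))) <= 3 * eta * r.
Proof.
  destruct p as [[a b] c], q as [[a' b'] c'].
  unfold p1, p2, p3; simpl fst; simpl snd.
  intros [N1 [N2 N3]] D H0 H1 H2. unfold p1, p2, p3 in N1, N2, N3; simpl in N1, N2, N3.
  assert (R0 : 0 <= r) by (pose proof (Rabs_pos (a' - a)); lra).
  destruct (mvt_near (fun t => u (t, b, c)) (fun t => G 0%nat (t, b, c)) a a' r)
    as [x [Hx Ex]]; auto.
  { intros t Ht. apply is_derive_translate.
    apply (D 0%nat (t, b, c)); [lia | apply near_intro; auto using Rabs_diag_le]. }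
  destruct (mvt_near (fun t => u (a', t, c)) (fun t => G 1%nat (a', t, c)) b b' r)
    as [y [Hy Ey]]; auto.
  { intros t Ht. apply is_derive_translate.
    apply (D 1%nat (a', t, c)); [lia | apply near_intro; auto using Rabs_diag_le]. }
  destruct (mvt_near (fun t => u (a', b', t)) (fun t => G 2%nat (a', b', t)) c c' r)
    as [z [Hz Ez]]; auto.
  { intros t Ht. apply is_derive_translate.
    apply (D 2%nat (a', b', t)); [lia | apply near_intro; auto using Rabs_diag_le]. }
  specialize (H0 x ltac:(apply near_intro; auto using Rabs_diag_le)).
  specialize (H1 a' y ltac:(apply near_intro; auto using Rabs_diag_le)).
  specialize (H2 a' b' z ltac:(apply near_intro; auto using Rabs_diag_le)).
  match goal with |- Rabs ?e <= _ => replace e with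
    ((G 0%nat (x, b, c) - G 0%nat (a, b, c)) * (a' - a)
     + (G 1%nat (a', y, c) - G 1%nat (a, b, c)) * (b' - b)
     + (G 2%nat (a', b', z) - G 2%nat (a, b, c)) * (c' - c)) by lra end.
  assert (P : forall s t, Rabs s <= eta -> Rabs t <= r -> Rabs (s * t) <= eta * r).
  { intros s t Hs Ht. rewrite Rabs_mult. apply Rmult_le_compat; auto using Rabs_pos. }
  eapply Rle_trans; [apply Rabs_triang | ].
  eapply Rle_trans; [apply Rplus_le_compat_r, Rabs_triang | ].
  pose proof (P _ _ H0 N1). pose proof (P _ _ H1 N2). pose proof (P _ _ H2 N3). lra.
Qed.

(** [G] is the gradient, with size and modulus of continuity controlled by the same [M]. The outer 3
    counts coordinates; the inner [3 * r] bounds the distance to a point of the cube. *)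
Definition sphere_taylor (u : R3 -> R) (a M d : R) : Prop :=
  exists G : nat -> R3 -> R, forall p, on_sphere p ->
    (forall i, (i < 3)%nat -> Rabs (G i p) <= M) /\
    forall r q, 0 < r < d -> near r p q ->
      Rabs (u q - u p - (G 0%nat p * (p1 q - p1 p) + G 1%nat p * (p2 q - p2 p)
                     + G 2%nat p * (p3 q - p3 p))) <= 3 * (M * Rpower (3 * r) a) * r.

Lemma Rpower_pos (x a : R) : 0 < Rpower x a.
Proof. apply exp_pos. Qed.

(** In the sum of the expansions at [q] and [q'] the gradient meets only $q+q'-2p$, of size $t^2$
    per coordinate, which gives $3Mt^2\le3Mt\,t^a$ as $t\le1$. The two remainders give
    $6M\,3^a\,t\,t^a$. *)
Lemma sphere_taylor_second_difference (u : R3 -> R) (a M d t : R) (p q q' : R3) :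
  0 < a <= 1 -> 0 < t -> t < d -> t <= 1 -> 0 <= M -> sphere_taylor u a M d ->
  on_sphere p -> near t p q -> near t p q' ->
  Rabs (p1 q + p1 q' - 2 * p1 p) <= t ^ 2 ->
  Rabs (p2 q + p2 q' - 2 * p2 p) <= t ^ 2 ->
  Rabs (p3 q + p3 q' - 2 * p3 p) <= t ^ 2 ->
  Rabs (u q + u q' - 2 * u p) <= (3 * M + 6 * M * Rpower 3 a) * (t * Rpower t a).
Proof.
  intros Ha Ht Htd Ht1 HM [G HG] Hp Nq Nq' S1 S2 S3.
  destruct (HG p Hp) as [B T].
  assert (T1 := T t q ltac:(lra) Nq). assert (T2 := T t q' ltac:(lra) Nq').
  rewrite <- Rpower_mult_distr in T1, T2 by lra.
  assert (Pt : t <= Rpower t a).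
  { rewrite <- (Rpower_1 t) at 1 by assumption. unfold Rpower.
    assert (L : ln t <= 0) by (rewrite <- ln_1; apply ln_le; lra).
    destruct (Rle_lt_or_eq_dec (1 * ln t) (a * ln t) ltac:(nra)) as [E | E].
    - left; now apply exp_increasing.
    - rewrite E; lra. }
  assert (P : forall g s, Rabs g <= M -> Rabs s <= t ^ 2 -> Rabs (g * s) <= M * t ^ 2).
  { intros g s Hg Hs. rewrite Rabs_mult. apply Rmult_le_compat; auto using Rabs_pos. }
  assert (P1 := P _ _ (B 0%nat ltac:(lia)) S1).
  assert (P2 := P _ _ (B 1%nat ltac:(lia)) S2).
  assert (P3 := P _ _ (B 2%nat ltac:(lia)) S3).
  apply Rabs_le_between in T1, T2, P1, P2, P3.
  assert (Q : M * t ^ 2 <= M * (t * Rpower t a)).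
  { apply Rmult_le_compat_l; auto. simpl; rewrite Rmult_1_r. apply Rmult_le_compat_l; lra. }
  apply Rabs_le. split; nra.
Qed.

Lemma cos_diff_sum (t : R) : Rabs (2 * (cos t - 1)) <= t ^ 2.
Proof.
  pose proof (half_angle t) as E.
  pose proof (Rabs_sin_half_le t) as H. pose proof (Rabs_pos (sin (t / 2))) as H0.
  replace (2 * (cos t - 1)) with (- (4 * Rabs (sin (t / 2)) ^ 2)) by lra.
  rewrite Rabs_Ropp, Rabs_pos_eq by (pose proof (pow2_ge_0 (Rabs (sin (t / 2)))); lra).
  rewrite <- (pow2_abs t).
  replace (4 * Rabs (sin (t / 2)) ^ 2) with ((2 * Rabs (sin (t / 2))) ^ 2) by ring.
  apply pow_incr; lra.
Qed.

Lemma phi_near_shift (x s : R * R) (t : R) : Rabs (fst s) + Rabs (snd s) <= t ->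
  near t (phi x) (phi (fst x + fst s, snd x + snd s)).
Proof.
  intros H. eapply near_le; [ | apply phi_near]. simpl.
  replace (fst x + fst s - fst x) with (fst s) by ring.
  replace (snd x + snd s - snd x) with (snd s) by ring.
  pose proof (Rabs_sin_half_le (fst s)). pose proof (Rabs_sin_half_le (snd s)). lra.
Qed.

Definition axis_step (t : R) (s : R * R) : Prop := s = (t, 0) \/ s = (0, t).

Definition diff2 (g : R * R -> C) (s x : R * R) : C :=
  Cminus (Cplus (g (fst x + fst s, snd x + snd s)) (g (fst x + - fst s, snd x + - snd s)))
         (Cmult (RtoC 2) (g x)).

Lemma scaled_bound (m w B : R) : Rabs m <= B -> -1 <= w <= 1 -> Rabs (m * w) <= B.
Proof.
  intros Hm Hw. rewrite Rabs_mult. assert (Rabs w <= 1) by (apply Rabs_le; lra).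
  pose proof (Rabs_pos m); pose proof (Rabs_pos w). nra.
Qed.

(** Addition formulas turn each second difference into $2(\cos t-1)$ times a number in $[-1,1]$, or
    into 0. *)
Lemma phi_second_difference (x s : R * R) (t : R) : axis_step t s ->
  let q := phi (fst x + fst s, snd x + snd s) in
  let q' := phi (fst x + - fst s, snd x + - snd s) in
  Rabs (p1 q + p1 q' - 2 * p1 (phi x)) <= t ^ 2 /\
  Rabs (p2 q + p2 q' - 2 * p2 (phi x)) <= t ^ 2 /\
  Rabs (p3 q + p3 q' - 2 * p3 (phi x)) <= t ^ 2.
Proof.
  assert (W : forall v w, -1 <= v <= 1 -> -1 <= w <= 1 -> -1 <= v * w <= 1) by (intros; nra).
  pose proof (COS_bound (fst x)). pose proof (SIN_bound (fst x)).
  pose proof (COS_bound (snd x)). pose proof (SIN_bound (snd x)).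
  pose proof (cos_diff_sum t) as B.
  intros [-> | ->]; unfold phi, p1, p2, p3; cbn [fst snd];
    rewrite ?Ropp_0, ?Rplus_0_r, !cos_plus, !sin_plus, !cos_neg, !sin_neg; repeat split.
  - match goal with |- Rabs ?e <= _ => replace e with
      (2 * (cos t - 1) * (cos (fst x) * sin (snd x))) by ring end.
    apply scaled_bound; auto.
  - match goal with |- Rabs ?e <= _ => replace e with
      (2 * (cos t - 1) * (sin (fst x) * sin (snd x))) by ring end.
    apply scaled_bound; auto.
  - match goal with |- Rabs ?e <= _ => replace e with 0 by ring end.
    rewrite Rabs_R0. apply pow2_ge_0.
  - match goal with |- Rabs ?e <= _ => replace e with
      (2 * (cos t - 1) * (cos (fst x) * sin (snd x))) by ring end.
    apply scaled_bound; auto.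
  - match goal with |- Rabs ?e <= _ => replace e with
      (2 * (cos t - 1) * (sin (fst x) * sin (snd x))) by ring end.
    apply scaled_bound; auto.
  - match goal with |- Rabs ?e <= _ => replace e with
      (2 * (cos t - 1) * cos (snd x)) by ring end.
    apply scaled_bound; auto.
Qed.

Lemma Cmod_le_Rabs (z : C) : Cmod z <= Rabs (fst z) + Rabs (snd z).
Proof.
  pose proof (Rabs_pos (fst z)); pose proof (Rabs_pos (snd z)).
  unfold Cmod. rewrite <- (sqrt_pow2 (Rabs (fst z) + Rabs (snd z))) by lra.
  apply sqrt_le_1_alt. rewrite <- (pow2_abs (fst z)), <- (pow2_abs (snd z)). nra.
Qed.

(** Taylor handles small [t]; for the remaining [t] the trivial bound $4B$ is absorbed into [K].
    Large steps do occur: the first shell uses $t=\pi/2$. *)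
Lemma diff2_bound (f : R3 -> C) (a M d B : R) :
  0 < a <= 1 -> 0 < d -> 0 <= M ->
  (forall p, on_sphere p -> Cmod (f p) <= B) ->
  sphere_taylor (fun p => fst (f p)) a M d ->
  sphere_taylor (fun p => snd (f p)) a M d ->
  exists K, 0 <= K /\ forall t s x, 0 < t -> axis_step t s ->
    Cmod (diff2 (dfs f) s x) <= K * (t * Rpower t a).
Proof.
  intros Ha Hd HM HB T1 T2.
  assert (B0 : 0 <= B).
  { eapply Rle_trans; [apply Cmod_ge_0 | apply (HB (phi (0, 0))), phi_on_sphere]. }
  set (K1 := 3 * M + 6 * M * Rpower 3 a).
  assert (K1p : 0 <= K1) by (unfold K1; pose proof (Rpower_pos 3 a); nra).
  (* Halving keeps the step strictly below [d]; the cap at 1 is what $t\le t^a$ requires. *)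
  set (e := Rmin (d / 2) 1).
  assert (He : 0 < e /\ e < d /\ e <= 1).
  { unfold e. repeat split.
    - apply Rmin_pos; lra.
    - eapply Rle_lt_trans; [apply Rmin_l | lra].
    - apply Rmin_r. }
  set (w := e * Rpower e a).
  assert (Hw : 0 < w) by (apply Rmult_lt_0_compat; [lra | apply Rpower_pos]).
  exists (2 * K1 + 4 * B / w).
  assert (Q : 0 <= 4 * B / w).
  { apply Rmult_le_pos; [lra | left; now apply Rinv_0_lt_compat]. }
  split; [lra | ]. intros t s x Ht Hs.
  assert (Pt : 0 < t * Rpower t a) by (apply Rmult_lt_0_compat; [lra | apply Rpower_pos]).
  destruct (Rlt_dec t e) as [Hte | Hte].
  - apply Rle_trans with (2 * K1 * (t * Rpower t a)); [ | nra].
    destruct (phi_second_difference x s t Hs) as [S1 [S2 S3]].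
    assert (N1 : near t (phi x) (phi (fst x + fst s, snd x + snd s))).
    { apply phi_near_shift. destruct Hs as [-> | ->]; simpl; rewrite Rabs_R0, Rabs_pos_eq; lra. }
    assert (N2 : near t (phi x) (phi (fst x + - fst s, snd x + - snd s))).
    { apply (phi_near_shift x (- fst s, - snd s)).
      destruct Hs as [-> | ->]; simpl; rewrite !Rabs_Ropp, Rabs_R0, Rabs_pos_eq; lra. }
    assert (D1 := sphere_taylor_second_difference _ a M d t _ _ _ Ha Ht ltac:(lra) ltac:(lra)
       HM T1 (phi_on_sphere x) N1 N2 S1 S2 S3).
    assert (D2 := sphere_taylor_second_difference _ a M d t _ _ _ Ha Ht ltac:(lra) ltac:(lra)
       HM T2 (phi_on_sphere x) N1 N2 S1 S2 S3).
    fold K1 in D1, D2.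
    eapply Rle_trans; [apply Cmod_le_Rabs | ].
    unfold diff2, dfs. cbn [fst snd Cminus Cplus Copp Cmult RtoC].
    match goal with |- Rabs ?e1 + Rabs ?e2 <= _ =>
      replace (Rabs e1) with (Rabs (fst (f (phi (fst x + fst s, snd x + snd s))) +
         fst (f (phi (fst x + - fst s, snd x + - snd s))) - 2 * fst (f (phi x))))
        by (f_equal; ring);
      replace (Rabs e2) with (Rabs (snd (f (phi (fst x + fst s, snd x + snd s))) +
         snd (f (phi (fst x + - fst s, snd x + - snd s))) - 2 * snd (f (phi x))))
        by (f_equal; ring) end.
    lra.
  - apply Rle_trans with (4 * B).
    + unfold diff2, dfs, Cminus.
      eapply Rle_trans; [apply Cmod_triangle | ]. rewrite Cmod_opp, Cmod_mult, Cmod_R, Rabs_pos_eq by lra.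
      pose proof (Cmod_triangle (f (phi (fst x + fst s, snd x + snd s)))
        (f (phi (fst x + - fst s, snd x + - snd s)))).
      pose proof (HB _ (phi_on_sphere x)).
      pose proof (HB _ (phi_on_sphere (fst x + fst s, snd x + snd s))).
      pose proof (HB _ (phi_on_sphere (fst x + - fst s, snd x + - snd s))). lra.
    + assert (w <= t * Rpower t a).
      { unfold w. apply Rmult_le_compat; try lra; [left; apply Rpower_pos | ].
        apply Rle_Rpower_l; lra. }
      apply Rle_trans with (4 * B / w * (t * Rpower t a)); [ | nra].
      replace (4 * B) with (4 * B / w * w) at 1 by (field; lra).
      now apply Rmult_le_compat_l.
Qed.

Lemma Ck_le (k k' : nat) (U : R3 -> Prop) (g : R3 -> C) :
  (k' <= k)%nat -> Ck k U g -> Ck k' U g.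
Proof.
  intros H [A B]; split.
  - intros b1 b2 b3 Hb x Hx. apply A; auto; lia.
  - intros b1 b2 b3 Hb. apply B; lia.
Qed.

(** * Taylor expansion of the extension, for its real and imaginary parts alike *)

Section Component.
Variable pr : C -> R.
Hypothesis pr_comp : pr = fst \/ pr = snd.

Lemma comp_le (z : C) : Rabs (pr z) <= Cmod z.
Proof.
  destruct pr_comp as [-> | ->].
  - exact (Rle_trans _ _ _ (Rmax_l _ _) (Rmax_Cmod z)).
  - exact (Rle_trans _ _ _ (Rmax_r _ _) (Rmax_Cmod z)).
Qed.

Lemma comp_minus (z w : C) : pr (Cminus z w) = pr z - pr w.
Proof. destruct pr_comp as [-> | ->]; reflexivity. Qed.

Lemma comp_is_derive (i : nat) (g : R3 -> C) (x : R3) : has_part i g x ->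
  is_derive (fun t => pr (g (Defs.shift x i t))) 0 (pr (dpart i g x)).
Proof.
  intros [H1 H2]. destruct pr_comp as [-> | ->]; simpl; now apply Derive_correct.
Qed.

Lemma comp_lipschitz (i : nat) (F : R3 -> C) (line : R -> R3) (a a' r M : R) :
  (forall x t, line (x + t) = Defs.shift (line x) i t) ->
  (forall t, Rabs (t - a) <= r -> has_part i F (line t) /\ Cmod (dpart i F (line t)) <= M) ->
  Rabs (a' - a) <= r -> Rabs (pr (F (line a')) - pr (F (line a))) <= M * r.
Proof.
  intros HL H Ha.
  destruct (mvt_near (fun t => pr (F (line t))) (fun t => pr (dpart i F (line t))) a a' r)
    as [c [Hc E]]; auto.
  - intros t Ht. apply is_derive_translate.
    apply (is_derive_ext (fun s => pr (F (Defs.shift (line t) i s)))).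
    + intros s; now rewrite HL.
    + apply comp_is_derive, H, Ht.
  - simpl in E. rewrite E, Rabs_mult. apply Rmult_le_compat; auto using Rabs_pos.
    eapply Rle_trans; [apply comp_le | apply H, Hc].
Qed.

Variables (U : R3 -> Prop) (fs : R3 -> C) (d : R).
Hypothesis tube : forall p q, on_sphere p -> near d p q -> U q.

Lemma sphere_taylor_intro (a M : R) :
  0 < d -> Ck 1 U fs ->
  (forall i, (i < 3)%nat -> forall x, U x -> Cmod (dpart i fs x) <= M) ->
  (forall p r, on_sphere p -> 0 < r < d ->
     (forall x, near r p (x, p2 p, p3 p) ->
        Rabs (pr (dpart 0 fs (x, p2 p, p3 p)) - pr (dpart 0 fs p)) <= M * Rpower (3 * r) a) /\
     (forall x y, near r p (x, y, p3 p) ->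
        Rabs (pr (dpart 1 fs (x, y, p3 p)) - pr (dpart 1 fs p)) <= M * Rpower (3 * r) a) /\
     (forall x y z, near r p (x, y, z) ->
        Rabs (pr (dpart 2 fs (x, y, z)) - pr (dpart 2 fs p)) <= M * Rpower (3 * r) a)) ->
  sphere_taylor (fun p => pr (fs p)) a M d.
Proof.
  intros Hd [E _] B H. exists (fun i p => pr (dpart i fs p)). intros p Hp. split.
  - intros i Hi. eapply Rle_trans; [apply comp_le | ]. apply B; auto.
    apply (tube p); auto. destruct p as [[x y] z].
    apply near_intro; apply Rabs_diag_le; lra.
  - intros r q Hr Nq. destruct (H p r Hp Hr) as [H0 [H1 H2]].
    apply (taylor1 (fun p => pr (fs p)) (fun i p => pr (dpart i fs p))); auto.
    intros i z Hi Nz. apply comp_is_derive.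
    assert (Uz : U z) by (apply (tube p); auto; apply near_le with r; auto; lra).
    destruct (E 0 0 0 ltac:(lia) z Uz)%nat as [P0 [P1 P2]].
    destruct i as [ | [ | [ | i]]]; [exact P0 | exact (P1 eq_refl) | exact (P2 eq_refl eq_refl) | lia].
Qed.

(** The Holder condition compares any two points of [U] directly, without a path between them.
    Allowing every large [M] lets both components share one constant. *)
Lemma sphere_taylor_holder (alpha : R) : 0 < d -> 0 < alpha -> Ckalpha 1 alpha U fs ->
  exists M0, forall M, M0 <= M -> sphere_taylor (fun p => pr (fs p)) alpha M d.
Proof.
  intros Hd Ha [HC HH].
  destruct (proj2 HC 1 0 0 ltac:(lia))%nat as [[B0 HB0] _].
  destruct (proj2 HC 0 1 0 ltac:(lia))%nat as [[B1 HB1] _].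
  destruct (proj2 HC 0 0 1 ltac:(lia))%nat as [[B2 HB2] _].
  destruct (HH 1 0 0 ltac:(lia))%nat as [M0 HM0].
  destruct (HH 0 1 0 ltac:(lia))%nat as [M1 HM1].
  destruct (HH 0 0 1 ltac:(lia))%nat as [M2 HM2].
  exists (Rabs B0 + Rabs B1 + Rabs B2 + Rabs M0 + Rabs M1 + Rabs M2). intros M HM.
  pose proof (Rle_abs B0). pose proof (Rle_abs B1). pose proof (Rle_abs B2).
  pose proof (Rle_abs M0). pose proof (Rle_abs M1). pose proof (Rle_abs M2).
  pose proof (Rabs_pos B0). pose proof (Rabs_pos B1). pose proof (Rabs_pos B2).
  pose proof (Rabs_pos M0). pose proof (Rabs_pos M1). pose proof (Rabs_pos M2).
  apply sphere_taylor_intro; auto.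
  - intros i Hi x Ux. destruct i as [ | [ | [ | i]]]; [ | | | lia].
    + apply Rle_trans with B0; [exact (HB0 x Ux) | lra].
    + apply Rle_trans with B1; [exact (HB1 x Ux) | lra].
    + apply Rle_trans with B2; [exact (HB2 x Ux) | lra].
  - intros p r Hp Hr.
    assert (Up : U p).
    { apply (tube p); auto. destruct p as [[x y] z]. apply near_intro; apply Rabs_diag_le; lra. }
    assert (X : forall (F : R3 -> C) (M' : R) (z : R3),
       (forall x y, U x -> U y -> x <> y -> Cmod (Cminus (F x) (F y)) <= M' * Rpower (dist3 x y) alpha) ->
       M' <= M -> near r p z -> Rabs (pr (F z) - pr (F p)) <= M * Rpower (3 * r) alpha).
    { intros F M' z HF HM' Nz.
      assert (Uz : U z) by (apply (tube p); auto; apply near_le with r; auto; lra).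
      pose proof (Rpower_pos (3 * r) alpha).
      (* [Rpower] has its intended meaning only at a positive base, and the Holder condition is
         stated for distinct points. *)
      destruct (classic (z = p)) as [-> | Hzp].
      - rewrite Rminus_diag_eq, Rabs_R0 by reflexivity. apply Rmult_le_pos; lra.
      - rewrite <- comp_minus. eapply Rle_trans; [apply comp_le | ].
        eapply Rle_trans; [apply HF; auto | ].
        pose proof (Rpower_pos (dist3 z p) alpha).
        apply Rle_trans with (M * Rpower (dist3 z p) alpha); [nra | ].
        apply Rmult_le_compat_l; [lra | ].
        apply Rle_Rpower_l; [lra | split; [ | apply dist3_near, Nz]].
        apply sqrt_lt_R0.
        pose proof (pow2_ge_0 (p1 z - p1 p)) as A1.
        pose proof (pow2_ge_0 (p2 z - p2 p)) as A2.
        pose proof (pow2_ge_0 (p3 z - p3 p)) as A3.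
        apply Rnot_le_lt; intros L. apply Hzp.
        destruct z as [[z1 z2] z3], p as [[q1 q2] q3]; unfold p1, p2, p3 in *; simpl in *.
        repeat f_equal; nra. }
    repeat split; intros.
    + apply (X (dpart 0 fs) M0); auto; lra.
    + apply (X (dpart 1 fs) M1); auto; lra.
    + apply (X (dpart 2 fs) M2); auto; lra.
Qed.

(** Bounded second derivatives control the gradient along segments in [U], so a point of the cube is
    joined to its centre by coordinate segments, each costing $Mr$. Taking them in the order $x,y,z$
    calls only for the mixed derivatives that [Dbeta] provides. *)
Lemma sphere_taylor_C2 : 0 < d -> Ck 2 U fs ->
  exists M0, forall M, M0 <= M -> sphere_taylor (fun p => pr (fs p)) 1 M d.
Proof.
  intros Hd HC.
  destruct (proj2 HC 1 0 0 ltac:(lia))%nat as [[B0 HB0] _].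
  destruct (proj2 HC 0 1 0 ltac:(lia))%nat as [[B1 HB1] _].
  destruct (proj2 HC 0 0 1 ltac:(lia))%nat as [[B2 HB2] _].
  destruct (proj2 HC 2 0 0 ltac:(lia))%nat as [[B00 HB00] _].
  destruct (proj2 HC 1 1 0 ltac:(lia))%nat as [[B01 HB01] _].
  destruct (proj2 HC 0 2 0 ltac:(lia))%nat as [[B11 HB11] _].
  destruct (proj2 HC 1 0 1 ltac:(lia))%nat as [[B02 HB02] _].
  destruct (proj2 HC 0 1 1 ltac:(lia))%nat as [[B12 HB12] _].
  destruct (proj2 HC 0 0 2 ltac:(lia))%nat as [[B22 HB22] _].
  exists (Rabs B0 + Rabs B1 + Rabs B2 + Rabs B00 + Rabs B01 + Rabs B11
          + Rabs B02 + Rabs B12 + Rabs B22). intros M HM.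
  assert (L : forall b s, s + Rabs b <= M -> 0 <= s -> b <= M /\ s <= M).
  { intros b s Hs H0. pose proof (Rle_abs b). pose proof (Rabs_pos b). lra. }
  (* Each pass peels off the last summand, until [Rabs B0 <= M] is left. *)
  repeat match goal with H : _ + Rabs ?b <= M |- _ =>
    apply L in H; [destruct H as [? H] | repeat apply Rplus_le_le_0_compat; apply Rabs_pos] end.
  assert (B0 <= M) by (eapply Rle_trans; [apply Rle_abs | exact HM]).
  assert (M0 : 0 <= M) by (eapply Rle_trans; [apply Rabs_pos | exact HM]).
  clear HM L.
  apply sphere_taylor_intro; auto.
  - apply Ck_le with 2%nat; auto.
  - intros i Hi x Ux. destruct i as [ | [ | [ | i]]]; [ | | | lia].
    + apply Rle_trans with B0; [exact (HB0 x Ux) | lra].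
    + apply Rle_trans with B1; [exact (HB1 x Ux) | lra].
    + apply Rle_trans with B2; [exact (HB2 x Ux) | lra].
  (* At exponent 1 the allowance is [M * (3 * r)], enough for three segments. *)
  - intros p r Hp Hr. rewrite Rpower_1 by lra.
    assert (V : forall z, near r p z -> U z).
    { intros z Nz; apply (tube p); auto; apply near_le with r; auto; lra. }
    destruct HC as [HE _]. destruct p as [[a b] c].
    unfold p1, p2, p3; simpl fst; simpl snd.
    assert (A : forall w, Rabs (w - w) <= r) by (intros; apply Rabs_diag_le; lra).
    assert (LX : forall F b' c', (forall t, Rabs (t - a) <= r ->
        has_part 0 F (t, b', c') /\ Cmod (dpart 0 F (t, b', c')) <= M) ->
        forall x, Rabs (x - a) <= r -> Rabs (pr (F (x, b', c')) - pr (F (a, b', c'))) <= M * r).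
    { intros F b' c' Hpart x Hx. apply (comp_lipschitz 0 F (fun t => (t, b', c'))); auto. }
    assert (LY : forall F a' c', (forall t, Rabs (t - b) <= r ->
        has_part 1 F (a', t, c') /\ Cmod (dpart 1 F (a', t, c')) <= M) ->
        forall y, Rabs (y - b) <= r -> Rabs (pr (F (a', y, c')) - pr (F (a', b, c'))) <= M * r).
    { intros F a' c' Hpart y Hy. apply (comp_lipschitz 1 F (fun t => (a', t, c'))); auto. }
    assert (LZ : forall F a' b', (forall t, Rabs (t - c) <= r ->
        has_part 2 F (a', b', t) /\ Cmod (dpart 2 F (a', b', t)) <= M) ->
        forall z, Rabs (z - c) <= r -> Rabs (pr (F (a', b', z)) - pr (F (a', b', c))) <= M * r).
    { intros F a' b' Hpart z Hz. apply (comp_lipschitz 2 F (fun t => (a', b', t))); auto. }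
    assert (N : forall x y z, Rabs (x - a) <= r -> Rabs (y - b) <= r -> Rabs (z - c) <= r -> U (x, y, z)).
    { intros; apply V, near_intro; auto. }
    assert (Mr : 0 <= M * r) by (apply Rmult_le_pos; lra).
    repeat split.
    + intros x [Nx _].
      eapply Rle_trans; [apply (LX (dpart 0 fs)); auto | lra].
      intros t Ht. assert (Ut : U (t, b, c)) by auto. split.
      * exact (proj1 (HE 1 0 0 ltac:(lia) _ Ut)%nat).
      * apply Rle_trans with B00; auto. exact (HB00 _ Ut).
    + intros x y [Nx [Ny _]]. unfold p1, p2 in Nx, Ny; simpl in Nx, Ny.
      assert (I1 : Rabs (pr (dpart 1 fs (x, y, c)) - pr (dpart 1 fs (a, y, c))) <= M * r).
      { apply (LX (dpart 1 fs)); auto. intros t Ht.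
        assert (Ut : U (t, y, c)) by auto. split.
        - exact (proj1 (HE 0 1 0 ltac:(lia) _ Ut)%nat).
        - apply Rle_trans with B01; auto. exact (HB01 _ Ut). }
      assert (I2 : Rabs (pr (dpart 1 fs (a, y, c)) - pr (dpart 1 fs (a, b, c))) <= M * r).
      { apply (LY (dpart 1 fs)); auto. intros t Ht.
        assert (Ut : U (a, t, c)) by auto. split.
        - exact (proj1 (proj2 (HE 0 1 0 ltac:(lia) _ Ut)) eq_refl)%nat.
        - apply Rle_trans with B11; auto. exact (HB11 _ Ut). }
      apply Rabs_le_between in I1, I2. apply Rabs_le. lra.
    + intros x y z [Nx [Ny Nz]]. unfold p1, p2, p3 in Nx, Ny, Nz; simpl in Nx, Ny, Nz.
      assert (I1 : Rabs (pr (dpart 2 fs (x, y, z)) - pr (dpart 2 fs (a, y, z))) <= M * r).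
      { apply (LX (dpart 2 fs)); auto. intros t Ht.
        assert (Ut : U (t, y, z)) by auto. split.
        - exact (proj1 (HE 0 0 1 ltac:(lia) _ Ut)%nat).
        - apply Rle_trans with B02; auto. exact (HB02 _ Ut). }
      assert (I2 : Rabs (pr (dpart 2 fs (a, y, z)) - pr (dpart 2 fs (a, b, z))) <= M * r).
      { apply (LY (dpart 2 fs)); auto. intros t Ht.
        assert (Ut : U (a, t, z)) by auto. split.
        - exact (proj1 (proj2 (HE 0 0 1 ltac:(lia) _ Ut)) eq_refl)%nat.
        - apply Rle_trans with B12; auto. exact (HB12 _ Ut). }
      assert (I3 : Rabs (pr (dpart 2 fs (a, b, z)) - pr (dpart 2 fs (a, b, c))) <= M * r).
      { apply (LZ (dpart 2 fs)); auto. intros t Ht.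
        assert (Ut : U (a, b, t)) by auto. split.
        - exact (proj2 (proj2 (HE 0 0 1 ltac:(lia) _ Ut)) eq_refl eq_refl)%nat.
        - apply Rle_trans with B22; auto. exact (HB22 _ Ut). }
      apply Rabs_le_between in I1, I2, I3. apply Rabs_le. lra.
Qed.

End Component.

(** Only $k=1$, $\alpha<1$ needs the Holder version; otherwise $k\ge2$, or $\alpha=1$ and the
    extension is $C^{k+1}$, so it is $C^2$ in either case. *)
Lemma Ckalpha_S2_taylor (k : nat) (alpha : R) (f : R3 -> C) :
  (1 <= k)%nat -> 0 < alpha <= 1 -> Ckalpha_S2 k alpha f ->
  exists (fs : R3 -> C) (a M d B : R),
    (forall x, on_sphere x -> fs x = f x) /\ 0 < a <= 1 /\ 0 < d /\ 0 <= M /\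
    (forall p, on_sphere p -> Cmod (fs p) <= B) /\ unif_cont_on on_sphere fs /\
    sphere_taylor (fun p => fst (fs p)) a M d /\
    sphere_taylor (fun p => snd (fs p)) a M d.
Proof.
  intros Hk Ha [U [fs [HU [HS [Hf HC]]]]].
  destruct (sphere_tube U HU HS) as [d [Hd tube]].
  assert (HCk : Ck 0 U fs).
  { destruct (Rlt_dec alpha 1); [destruct HC as [HC _] | ]; eapply Ck_le; try exact HC; lia. }
  destruct (proj2 HCk 0 0 0 ltac:(lia))%nat as [[B HB] UC].
  assert (X : exists a, 0 < a <= 1 /\ forall pr, pr = fst \/ pr = snd ->
     exists M0, forall M, M0 <= M -> sphere_taylor (fun p => pr (fs p)) a M d).
  { assert (C2 : Ck 2 U fs -> exists a, 0 < a <= 1 /\ forall pr, pr = fst \/ pr = snd ->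
     exists M0, forall M, M0 <= M -> sphere_taylor (fun p => pr (fs p)) a M d).
    { intros H2. exists 1; split; [lra | ]. intros pr Hpr. now apply sphere_taylor_C2 with U. }
    destruct (Rlt_dec alpha 1) as [Hlt | Hge].
    - destruct (Nat.eq_dec k 1) as [-> | Hk1].
      + exists alpha; split; [lra | ]. intros pr Hpr.
        apply sphere_taylor_holder with U; auto; lra.
      + apply C2. destruct HC as [HC _]. apply Ck_le with k; auto; lia.
    - apply C2. apply Ck_le with (S k); auto; lia. }
  destruct X as [a [Ha' X]].
  destruct (X fst (or_introl eq_refl)) as [M1 T1].
  destruct (X snd (or_intror eq_refl)) as [M2 T2].
  exists fs, a, (Rabs M1 + Rabs M2), d, B.
  pose proof (Rle_abs M1). pose proof (Rle_abs M2).
  pose proof (Rabs_pos M1). pose proof (Rabs_pos M2).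
  split; [exact Hf | ]. split; [exact Ha' | ]. split; [exact Hd | ]. split; [lra | ].
  split; [intros p Hp; exact (HB p (HS p Hp)) | ].
  split; [ | split; [apply T1; lra | apply T2; lra]].
  intros eps He. destruct (UC eps He) as [dl [Hdl H']]. exists dl; auto.
Qed.

(** * Absolute summability *)

Lemma ccont_shift (g : R * R -> C) (a b : R) :
  ccont g -> ccont (fun x => g (fst x + a, snd x + b)).
Proof.
  intros [H1 H2]; split.
  - apply (cont_comp_pair (fun x => fst (g x))); auto with cont.
  - apply (cont_comp_pair (fun x => snd (g x))); auto with cont.
Qed.

#[local] Hint Resolve ccont_shift : cont.

Lemma ccont_diff2 (g : R * R -> C) (s : R * R) : ccont g -> ccont (diff2 g s).
Proof. intros H; unfold diff2; auto 10 with cont. Qed.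

Lemma fcoef_diff2 (g : R * R -> C) (s : R * R) (n : Z * Z) :
  ccont g -> cperiodic g ->
  fcoef (diff2 g s) n = Cmult (RtoC (2 * cos (ip n s) - 2)) (fcoef g n).
Proof.
  intros Hg Pg.
  rewrite (fcoef_ext _ (fun x => Cminus
    (Cplus (g (fst x + fst s, snd x + snd s)) (g (fst x + - fst s, snd x + - snd s)))
    (Cmult (RtoC 2) (g x)))) by reflexivity.
  rewrite fcoef_minus, fcoef_plus, fcoef_scal by auto 10 with cont.
  rewrite (fcoef_shift g s), (fcoef_shift g (- fst s, - snd s)) by assumption.
  replace (ip n (- fst s, - snd s)) with (- ip n s) by (unfold ip; simpl; ring).
  rewrite RtoC_minus, <- cis_opp_plus. ring.
Qed.

Lemma Rpower_pow_base (x a : R) (j : nat) : 0 < x -> Rpower (x ^ j) a = Rpower x a ^ j.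
Proof.
  intros Hx. induction j as [ | j IH]; simpl.
  - unfold Rpower. now rewrite ln_1, Rmult_0_r, exp_0.
  - now rewrite <- IH, Rpower_mult_distr by (auto; now apply pow_lt).
Qed.

(** The step is chosen so that $2^jt=\pi/2$: the angle $|m|t$ then lies in $[\pi/2,\pi)$, and
    $(2\cos-2)^2\ge4$ on the shell. *)
Lemma dyadic_cos (j : nat) (m : Z) : (2 ^ Z.of_nat j <= Z.abs m < 2 ^ Z.of_nat (S j))%Z ->
  cos (IZR m * (PI / 2 * (1 / 2) ^ j)) <= 0.
Proof.
  intros [H1 H2]. rewrite Nat2Z.inj_succ, Z.pow_succ_r in H2 by lia.
  apply IZR_le in H1. apply IZR_lt in H2. rewrite mult_IZR in H2.
  rewrite <- pow_IZR in H1, H2. rewrite abs_IZR in H1, H2.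
  set (t := PI / 2 * (1 / 2) ^ j).
  assert (Pq : 0 < (1 / 2) ^ j) by (apply pow_lt; lra).
  assert (Pt : 0 < t) by (apply Rmult_lt_0_compat; [pose proof PI_RGT_0; lra | assumption]).
  assert (E : 2 ^ j * t = PI / 2).
  { unfold t. replace (2 ^ j * (PI / 2 * (1 / 2) ^ j)) with (PI / 2 * (2 ^ j * (1 / 2) ^ j)) by ring.
    rewrite <- Rpow_mult_distr. replace (2 * (1 / 2)) with 1 by field. rewrite pow1; ring. }
  assert (Q : cos (Rabs (IZR m) * t) <= 0).
  { pose proof PI_RGT_0. apply cos_le_0; nra. }
  revert Q. unfold Rabs; destruct (Rcase_abs (IZR m)); auto.
  now rewrite Ropp_mult_distr_l_reverse, cos_neg.
Qed.

Lemma fcoef_summable (g : R * R -> C) (a K : R) :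
  ccont g -> cperiodic g -> 0 < a ->
  (forall t s x, 0 < t -> axis_step t s -> Cmod (diff2 g s x) <= K * (t * Rpower t a)) ->
  exists B, forall l, NoDup l -> rsum l (fun n => Cmod (fcoef g n)) <= B.
Proof.
  intros Hg Pg Ha HK.
  set (r := Rpower (1 / 2) a).
  set (w := PI / 2 * Rpower (PI / 2) a).
  assert (Hr : 0 < r < 1).
  { split; [apply Rpower_pos | ]. unfold r, Rpower.
    assert (ln (1 / 2) < 0) by (rewrite <- ln_1; apply ln_increasing; lra).
    apply Rlt_le_trans with (exp 0); [apply exp_increasing; nra | rewrite exp_0; lra]. }
  (* With $r=2^{-a}$, $b=K\,t\,t^a$ equals $Kw\,2^{-j}r^j$. The Bessel bounds for the two axes give
     $4\sum|c_n|^2\le2b^2$, hence the factor [1 / 2]. *)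
  apply (dyadic_bounded (fun n => Cmod (fcoef g n)) (1 / 2 * (K * w) ^ 2) r); auto.
  { intros n; apply Cmod_ge_0. }
  { pose proof (pow2_ge_0 (K * w)); lra. }
  intros j l Hl Hsh.
  set (t := PI / 2 * (1 / 2) ^ j).
  assert (Pq : 0 < (1 / 2) ^ j) by (apply pow_lt; lra).
  assert (P2 : 0 < PI / 2) by (pose proof PI_RGT_0; lra).
  assert (Pt : 0 < t) by now apply Rmult_lt_0_compat.
  assert (B1 := bessel (diff2 g (t, 0)) l _ (ccont_diff2 g (t, 0) Hg) Hl
                 (fun x => HK t (t, 0) x Pt (or_introl eq_refl))).
  assert (B2 := bessel (diff2 g (0, t)) l _ (ccont_diff2 g (0, t) Hg) Hl
                 (fun x => HK t (0, t) x Pt (or_intror eq_refl))).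
  replace (1 / 2 * (K * w) ^ 2 * ((1 / 4) ^ j * (r ^ j * r ^ j)))
    with (1 / 2 * (K * (t * Rpower t a)) ^ 2).
  2:{ unfold t at 2. rewrite <- Rpower_mult_distr, Rpower_pow_base by (auto; lra).
      fold r. unfold t, w. replace (1 / 4) with (1 / 2 * (1 / 2)) by field.
      rewrite (Rpow_mult_distr (1 / 2) (1 / 2)). ring. }
  apply Rle_trans with (1 / 4 * (rsum l (fun n => csq (fcoef (diff2 g (t, 0)) n))
                        + rsum l (fun n => csq (fcoef (diff2 g (0, t)) n)))); [ | lra].
  rewrite <- rsum_plus, <- rsum_scal. apply rsum_le; intros n Hn.
  rewrite !fcoef_diff2, !csq_Cmod, !Cmod_mult, !Cmod_R, !Rpow_mult_distr, !pow2_abs by assumption.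
  set (c2 := Cmod (fcoef g n) ^ 2).
  assert (0 <= c2) by apply pow2_ge_0.
  specialize (Hsh n Hn). unfold znorm in Hsh.
  replace (ip n (t, 0)) with (IZR (fst n) * t) by (unfold ip; simpl; ring).
  replace (ip n (0, t)) with (IZR (snd n) * t) by (unfold ip; simpl; ring).
  assert (S : forall y, 0 <= (2 * cos y - 2) ^ 2) by (intros; apply pow2_ge_0).
  assert (Q : forall m, (2 ^ Z.of_nat j <= Z.abs m < 2 ^ Z.of_nat (Datatypes.S j))%Z ->
     4 <= (2 * cos (IZR m * t) - 2) ^ 2).
  { intros m Hm. assert (C := dyadic_cos j m Hm). fold t in C. nra. }
  pose proof (S (IZR (fst n) * t)). pose proof (S (IZR (snd n) * t)).
  (* The coordinate that attains the max norm lies in the dyadic interval, so the difference along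
     its axis supplies the factor 4. *)
  destruct (Z.max_spec (Z.abs (fst n)) (Z.abs (snd n))) as [[_ E] | [_ E]]; rewrite E in Hsh.
  - specialize (Q _ Hsh). nra.
  - specialize (Q _ Hsh). nra.
Qed.

(** * The series on the sphere *)

Lemma cis_IZR_PI (m : Z) : cis (IZR m * PI) = RtoC (sgn1 m).
Proof.
  unfold sgn1. destruct (Z.even m) eqn:E.
  - apply Z.even_spec in E. destruct E as [k ->].
    rewrite <- cis_0, <- (cis_period 0 k). f_equal. rewrite mult_IZR; ring.
  - rewrite <- Z.negb_odd in E. apply Bool.negb_false_iff, Z.odd_spec in E.
    destruct E as [k ->].
    replace (IZR (2 * k + 1) * PI) with (PI + IZR k * (2 * PI)).
    + rewrite cis_period. unfold cis, RtoC. now rewrite cos_PI, sin_PI.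
    + rewrite plus_IZR, mult_IZR; ring.
Qed.

(* phi(x1, -x2) = phi(x1 + pi, x2) *)
Lemma fcoef_dfs_Mref (f : R3 -> C) (n : Z * Z) : ccont (dfs f) ->
  fcoef (dfs f) (Mref n) = Cmult (RtoC (sgn1 (fst n))) (fcoef (dfs f) n).
Proof.
  intros H. rewrite <- fcoef_reflect by assumption.
  rewrite (fcoef_ext _ (fun x => dfs f (fst x + fst (PI, 0), snd x + snd (PI, 0)))).
  - rewrite fcoef_shift by auto using cperiodic_dfs.
    rewrite <- cis_IZR_PI. do 2 f_equal. unfold ip; simpl; ring.
  - intros x; unfold dfs, phi; simpl. rewrite Rplus_0_r, sin_neg, cos_neg, neg_cos, neg_sin.
    now rewrite !Ropp_mult_distr_l_reverse, !Ropp_mult_distr_r_reverse.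
Qed.

(** Points with $n_2=0$ are fixed by [Mref] and are not copied, which keeps the list duplicate-free
    and agrees with the case distinction in [en]. *)
Definition mirror (Om : list (Z * Z)) : list (Z * Z) :=
  Om ++ map Mref (filter (fun n => negb (Z.eqb (snd n) 0)) Om).

Lemma mirror_In (Om : list (Z * Z)) (n : Z * Z) :
  In n (mirror Om) <-> In n Om \/ exists m, In m Om /\ n = Mref m.
Proof.
  unfold mirror. rewrite in_app_iff, in_map_iff. split.
  - intros [H | [m [E H]]]; auto. right; exists m. apply filter_In in H. now split.
  - intros [H | [m [H E]]]; auto. destruct (Z.eqb (snd m) 0) eqn:E0.
    + left. apply Z.eqb_eq in E0. subst n. destruct m as [a b]; simpl in E0; subst b. exact H.
    + right; exists m; split; auto. apply filter_In. rewrite E0. now split.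
Qed.

Lemma mirror_NoDup (Om : list (Z * Z)) :
  NoDup Om -> (forall n, In n Om -> (0 <= snd n)%Z) -> NoDup (mirror Om).
Proof.
  intros HN HP. apply NoDup_app; auto.
  - apply FinFun.Injective_map_NoDup; [ | now apply NoDup_filter].
    intros [a b] [a' b'] E. unfold Mref in E; simpl in E. injection E as -> E. f_equal; lia.
  - intros n H1 H2. apply in_map_iff in H2. destruct H2 as [m [E H2]].
    apply filter_In in H2. destruct H2 as [H2 H3].
    apply Bool.negb_true_iff, Z.eqb_neq in H3.
    specialize (HP n H1) as P1. specialize (HP m H2) as P2. subst n; simpl in P1. lia.
Qed.

Lemma csum_map {A B : Type} (h : A -> B) (l : list A) (F : B -> C) :
  csum (map h l) F = csum l (fun a => F (h a)).
Proof. induction l as [ | a l IH]; simpl; congruence. Qed.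

(** Termwise: by the symmetry of the coefficients, the second half of $c_nb_n$ is the Fourier term
    of frequency $M(n)$. *)
Lemma SOmega_mirror (Om : list (Z * Z)) (f : R3 -> C) (xi : R3) : ccont (dfs f) ->
  SOmega Om f xi = FOmega (mirror Om) (dfs f) (phi_inv xi).
Proof.
  intros H. unfold SOmega, FOmega, mirror.
  rewrite csum_app, csum_map, csum_filter, <- csum_plus.
  apply csum_ext_in; intros n _. unfold bn, en.
  destruct (Z.eq_dec (snd n) 0) as [E | E].
  - rewrite E; simpl; ring.
  - rewrite (proj2 (Z.eqb_neq _ _) E); simpl. rewrite fcoef_dfs_Mref by assumption. ring.
Qed.

Lemma nnsum_ext (a : Z * Z -> R) (P Q : Z * Z -> Prop) :
  (forall n, P n <-> Q n) -> nnsum a P = nnsum a Q.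
Proof.
  intros H. apply Lub_Rbar_eqset. intros s.
  split; intros [l [Hl [HP E]]]; exists l; repeat split; auto;
    refine (Forall_impl _ _ HP); intros n; apply H.
Qed.

Theorem theorem5p5 (k : nat) (alpha : R) (f : R3 -> C) :
  (1 <= k)%nat -> 0 < alpha <= 1 -> Ckalpha_S2 k alpha f ->
  (* absolute summability of the Fourier coefficients of the DFS function *)
  Rbar_lt (nnsum (fun n => Cmod (fcoef (dfs f) n)) (fun _ => True)) p_infty /\
  (* uniform convergence on T^2 along expanding exhausting finite sets *)
  (forall Oms : nat -> list (Z * Z),
     (forall h, NoDup (Oms h)) ->
     (forall h, incl (Oms h) (Oms (S h))) ->
     (forall n, exists h, In n (Oms h)) ->
     forall eps, 0 < eps -> exists H, forall h, (H <= h)%nat -> forall x : R * R,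
       Cmod (Cminus (dfs f x) (FOmega (Oms h) (dfs f) x)) <= eps) /\
  (* error bound on T^2 *)
  (forall Om : list (Z * Z), NoDup Om -> forall x : R * R,
     Rbar_le (Cmod (Cminus (dfs f x) (FOmega Om (dfs f) x)))
             (nnsum (fun n => Cmod (fcoef (dfs f) n)) (fun n => ~ In n Om))) /\
  (* uniform convergence of the DFS Fourier series on S^2 *)
  (forall Oms : nat -> list (Z * Z),
     (forall h, NoDup (Oms h)) ->
     (forall h n, In n (Oms h) -> (0 <= snd n)%Z) ->
     (forall h, incl (Oms h) (Oms (S h))) ->
     (forall n, (0 <= snd n)%Z -> exists h, In n (Oms h)) ->
     forall eps, 0 < eps -> exists H, forall h, (H <= h)%nat -> forall xi : R3,
       on_sphere xi -> Cmod (Cminus (f xi) (SOmega (Oms h) f xi)) <= eps) /\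
  (* error bound on S^2 *)
  (forall Om : list (Z * Z), NoDup Om -> (forall n, In n Om -> (0 <= snd n)%Z) ->
     forall xi : R3, on_sphere xi ->
     Rbar_le (Cmod (Cminus (f xi) (SOmega Om f xi)))
             (nnsum (fun n => Cmod (fcoef (dfs f) n))
                    (fun n => ~ In n Om /\ ~ (exists m, In m Om /\ n = Mref m)))).
Proof.
  intros Hk Ha Hf.
  destruct (Ckalpha_S2_taylor k alpha f Hk Ha Hf)
    as [fs [a [M [d [B [Efs [Ha' [Hd [HM [HB [HU [T1 T2]]]]]]]]]]]].
  (* [fs] and [f] may differ off the sphere, but [dfs] samples only points on it. *)
  assert (E : dfs fs = dfs f).
  { apply functional_extensionality; intros x. apply Efs, phi_on_sphere. }
  destruct (diff2_bound fs a M d B Ha' Hd HM HB T1 T2) as [K [HK0 HK]].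
  assert (Kg := korovkin_dfs fs B HB HU). rewrite E in *.
  assert (Cg := korovkin_ccont _ Kg).
  destruct (fcoef_summable (dfs f) a K Cg (cperiodic_dfs f) (proj1 Ha') HK) as [S HS].
  assert (Ef : forall xi, on_sphere xi -> f xi = dfs f (phi_inv xi)).
  { intros xi Hxi; unfold dfs; now rewrite phi_phi_inv. }
  repeat split.
  - apply Rbar_le_lt_trans with S; [ | exact I]. apply nnsum_le; auto.
  - intros Oms. now apply fourier_uniform with S.
  - intros Om HOm x. now apply fourier_error.
  - intros Oms HN HP HI HE eps He.
    destruct (fourier_uniform (dfs f) S (fun h => mirror (Oms h)) Cg Kg HS) with (eps := eps)
      as [H HH]; auto.
    + intros h; apply mirror_NoDup; auto. intros n; apply HP.
    + intros h n. rewrite !mirror_In. intros [H | [m [H Em]]]; [left | right; exists m; split]; auto; now apply HI.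
    (* Indices in the lower half plane are reached through their reflection. *)
    + intros n. destruct (Z.le_gt_cases 0 (snd n)) as [Hn | Hn].
      * destruct (HE n Hn) as [h Hh]. exists h. apply mirror_In; auto.
      * destruct (HE (Mref n)) as [h Hh]; [simpl; lia | ].
        exists h. apply mirror_In. right; exists (Mref n); split; auto.
        destruct n; unfold Mref; simpl; f_equal; lia.
    + exists H. intros h Hh xi Hxi.
      rewrite Ef, SOmega_mirror by assumption. now apply HH.
  - intros Om HOm HP xi Hxi. rewrite Ef, SOmega_mirror by assumption.
    rewrite (nnsum_ext _ _ (fun n => ~ In n (mirror Om))).
    + apply fourier_error; auto. now apply mirror_NoDup.
    + intros n. rewrite mirror_In. tauto.
Qed.
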